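(* Assume the standing setup, let $(\hat\sigma,\varphi)$ be fine, let $\nu$ be the fixed conformal measure and $\mu$ the $\hat\sigma$-invariant random measure with $\mu_x=\rho_x\nu_x$. Let $p,q\in[1,\infty]$ with $\frac1p+\frac1q=1$. Then there exist constants $b>0$ and $\vartheta\in(0,1)$ such that for every $g\in L^{1,p}_\nu(\Omega)$, every $h\in\mathcal H^q_\alpha(\Omega)$ with $\int_{E_x^\infty}h_x\,d\mu_x=0$ for $m$-a.e. $x$, and every $n\ge1$, $$\Big|\int_\Omega(g\circ\hat\sigma^n)\,h\,d\mu\Big|=\Big|\int_X\int_{E_x^\infty}(g_{\theta^n(x)}\circ\sigma_x^n)\,h_x\,d\mu_x\,dm(x)\Big|\le b\,\vartheta^n\,|g|^{1,p}_\nu\,|h|_{\alpha,q}.$$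
   Context: Standing setup. $(X,\mathcal F,m)$ is a complete probability space and $\theta:X\to X$ is an invertible measurable map preserving $m$. $E=\mathbb N$, and $x\mapsto A(x)$ is a measurable map into $\{0,1\}$-matrices indexed by $E\times E$. $E_x^n$ is the set of words $\omega_0\cdots\omega_n\in E^{n+1}$ with $A_{\omega_i\omega_{i+1}}(\theta^i(x))=1$ for $0\le i\le n-1$; $E_x^\infty$ the set of $\omega\in E^{\mathbb N}$ with $A_{\omega_i\omega_{i+1}}(\theta^i(x))=1$ for all $i$. $[F]_x=\{\tau\in E_x^\infty:\tau_0\in F\}$, $[0,\dots,l]_x=[\{0,\dots,l\}]_x$, complements in $E_x^\infty$. Metric $d(\omega,\tau)=e^{-\min\{n:\omega_n\ne\tau_n\}}$. $\sigma_x:E_x^\infty\to E_{\theta(x)}^\infty$ is the left shift, $\sigma_x^n=\sigma_{\theta^{n-1}(x)}\circ\cdots\circ\sigma_x$, $\Omega=\bigcup_x\{x\}\times E_x^\infty$, $\hat\sigma(x,\omega)=(\theta(x),\sigma_x\omega)$, $g_x=g(x,\cdot)$. $\hat\sigma$ is topologically mixing: for all $a,b\in E$ there is $N$ with: for all $n\ge N$, $x\in X$ there is a word $\omega$ of length $n+1$ with $a\omega b\in E_x^{n+2}$. Fix $\alpha>0$; $v_\alpha(g)=\sup\{|g(\tau)-g(\omega)|/d(\tau,\omega)^\alpha:\tau\ne\omega,\tau_0=\omega_0\}$, $\mathcal H_\alpha(E_x^\infty)$ = bounded continuous $g$ with $v_\alpha(g)<\infty$, $\|g\|_\alpha=\|g\|_\infty+v_\alpha(g)$.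 For $p\in[1,\infty]$: $\mathcal H^p_\alpha(\Omega)$ is the space of measurable $h:\Omega\to\mathbb R$ with $h_x\in\mathcal H_\alpha(E_x^\infty)$ for a.e. $x$ and $x\mapsto\|h_x\|_\alpha$ in $L^p(m)$, with norm $|h|_{\alpha,p}=\|\,x\mapsto\|h_x\|_\alpha\|_{L^p(m)}$; $L^{1,p}_\nu(\Omega)$ is the space of measurable $g:\Omega\to\mathbb R$ with $g_x\in L^1(\nu_x)$ a.e. and $x\mapsto\|g_x\|_{L^1(\nu_x)}$ in $L^p(m)$, with norm $|g|^{1,p}_\nu=\|\,x\mapsto\|g_x\|_{L^1(\nu_x)}\|_{L^p(m)}$. Summable potential: measurable $\varphi:\Omega\to\mathbb R$, $\varphi_x$ continuous, $\operatorname{ess\,sup}_xv_\alpha(\varphi_x)<\infty$, for each $e$ constants $0<c_e<C_e$ with $c_e\le e^{\varphi_x}\le C_e$ on $[e]_x$ a.e., and $\lim_{l\to\infty}\operatorname{ess\,sup}_x\sup\mathcal L_x(1_{[0,\dots,l]_x^c})=0$, where $\mathcal L_xg(\omega)=\sum_{e:\,A_{e\omega_0}(x)=1}g(e\omega)e^{\varphi_x(e\omega)}$. (A): for each $e$ some $M_e>0$ with $M_e^{-1}\le\mathcal L_x1$ on $[e]_{\theta(x)}$ a.e.; (B): $\lim_{e\to\infty}\operatorname{ess\,sup}_x\sup_{[e]_{\theta(x)}}\mathcal L_x1=0$; (C): there are $0<\kappa<1/4$ and finite $F\subset E$ with $\sup\mathcal L_x(1_{E_x^\infty\setminus[F]_x})\le\kappa\inf_{[F]_{\theta(x)}}\mathcal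 L_x1$ a.e. Fine: $\varphi$ summable and (A),(B),(C). Random measures: probability measures on $\Omega$ with marginal $m$ and disintegrations $\nu_x$ on $E_x^\infty$. Fixed conformal measure: a random measure $\nu$ with measurable $\lambda:X\to(0,\infty)$, $\operatorname{ess\,sup}|\log\lambda|<\infty$, $\int\mathcal L_xg\,d\nu_{\theta(x)}=\lambda_x\int g\,d\nu_x$ for bounded continuous $g$, and $\nu_x([F]_x)\ge1/2$ a.e. $\rho\in\mathcal H_\alpha(\Omega)$ is the positive function with $\int\rho_xd\nu_x=1$ and $\lambda_x^{-1}\mathcal L_x\rho_x=\rho_{\theta(x)}$ a.e. (Theorem 2), and $\mu$ is the random measure with $\mu_x=\rho_x\nu_x$, which is $\hat\sigma$-invariant. *)

(* Defs.v *)
From HB Require Import structures.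
From mathcomp Require Import all_boot all_order all_algebra.
From mathcomp Require Import all_classical all_reals all_analysis.
From mathcomp Require Import ess_sup_inf.
Set Implicit Arguments. Unset Strict Implicit. Unset Printing Implicit Defensive.
Import Order.TTheory GRing.Theory Num.Theory.
Import numFieldNormedType.Exports.
Local Open Scope classical_set_scope.
Local Open Scope ring_scope.

(* The full shift space E^N with E = nat, equipped with the cylinder   *)
(* sigma-algebra (= Borel sigma-algebra of the metric d below).        *)
Definition cylinders : set (set (nat -> nat)) :=
  [set B | exists i k : nat, B = [set w | w i = k]].
Definition Seq := g_sigma_algebraType cylinders.

Definition shiftn (n : nat) (w : nat -> nat) : nat -> nat := fun i => w (i + n)%N.
Definition scons (e : nat) (w : nat -> nat) : nat -> nat :=
  fun i => if i is j.+1 then w j else e.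

Lemma exists_neqb (w t : nat -> nat) :
  (exists n, w n <> t n) -> exists n, w n != t n.
Proof. by case=> n /eqP H; exists n. Qed.

Definition seq_dist {R : realType} (w t : nat -> nat) : R :=
  match pselect (exists n, w n <> t n) with
  | left H => expR (- ((ex_minn (exists_neqb H))%:R))
  | right _ => 0
  end.

Section Fibres.
Context {R : realType} {d : measure_display} {X : measurableType d}.
Local Open Scope ereal_scope.

Definition Efib (theta : X -> X) (A : X -> nat -> nat -> bool) (x : X) : set Seq :=
  [set w | forall i : nat, A (iter i theta x) (w i) (w i.+1)].
Definition Omega (theta : X -> X) (A : X -> nat -> nat -> bool) : set (X * Seq) :=
  [set z | Efib theta A z.1 z.2].
Definition cyl1 (theta : X -> X) (A : X -> nat -> nat -> bool) (x : X) (e : nat) : set Seq :=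
  [set w | Efib theta A x w /\ w 0%N = e].
Definition cylF (theta : X -> X) (A : X -> nat -> nat -> bool) (x : X) (F : set nat) : set Seq :=
  [set w | Efib theta A x w /\ F (w 0%N)].

Definition fsup (D : set Seq) (f : Seq -> \bar R) : \bar R := ereal_sup (f @` D).
Definition finf (D : set Seq) (f : Seq -> \bar R) : \bar R := ereal_inf (f @` D).

(* sup norm over D (sup of |g|, with the convention sup of the empty set = 0) *)
Definition sup_norm (D : set Seq) (g : Seq -> R) : \bar R :=
  ereal_sup ([set 0] `|` [set (`|g w|)%:E | w in D]).

Definition var_alpha (alpha : R) (D : set Seq) (g : Seq -> R) : \bar R :=
  ereal_sup ([set 0] `|`
    [set y | exists t w : nat -> nat,
       [/\ D t, D w, t <> w, t 0%N = w 0%N &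
           y = (`|g t - g w| / (seq_dist t w `^ alpha))%:E]]).

Definition cont_on (D : set Seq) (g : Seq -> R) : Prop :=
  forall w, D w -> forall eps : R, (0 < eps)%R ->
    exists2 delta : R, (0 < delta)%R &
      forall t, D t -> (seq_dist w t < delta)%R -> (`|g t - g w| < eps)%R.

Definition Holder (alpha : R) (D : set Seq) (g : Seq -> R) : Prop :=
  [/\ cont_on D g, sup_norm D g < +oo & var_alpha alpha D g < +oo].

Definition holder_norm (alpha : R) (D : set Seq) (g : Seq -> R) : R :=
  fine (sup_norm D g + var_alpha alpha D g).

Definition Lterm (A : X -> nat -> nat -> bool) (phi : X -> Seq -> R) (x : X)
  (g : Seq -> R) (w : Seq) (e : nat) : R :=
  if A x e (w 0%N) then (g (scons e w) * expR (phi x (scons e w)))%R else 0%R.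
(* real-valued version (a convergent series under the standing hypotheses) *)
Definition Lop (A : X -> nat -> nat -> bool) (phi : X -> Seq -> R) (x : X)
  (g : Seq -> R) (w : Seq) : R := limn (series (Lterm A phi x g w)).
(* extended-real version, for nonnegative g *)
Definition Lpos (A : X -> nat -> nat -> bool) (phi : X -> Seq -> R) (x : X)
  (g : Seq -> R) (w : Seq) : \bar R :=
  \sum_(0 <= e <oo) (Lterm A phi x g w e)%:E.

Definition ind_big (l : nat) : Seq -> R := fun t => if (l < t 0%N)%N then 1%R else 0%R.
Definition ind_notin (F : set nat) : Seq -> R := fun t => if t 0%N \in F then 0%R else 1%R.

Definition in_Lp (m : {measure set X -> \bar R}) (p : \bar R) (f : X -> R) : Prop :=
  measurable_fun setT f /\ Lnorm m p (EFin \o f) < +oo.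

Definition conj_exp (p q : \bar R) : Prop :=
  match p, q with
  | p%:E, q%:E => (1 <= p)%R /\ (1 <= q)%R /\ (p^-1 + q^-1 = 1)%R
  | +oo, q%:E => q = 1%R
  | p%:E, +oo => p = 1%R
  | _, _ => False
  end.

Definition inv_mpt (m : {measure set X -> \bar R}) (theta : X -> X) : Prop :=
  measure_is_complete m /\
  exists thinv : X -> X,
    [/\ cancel theta thinv, cancel thinv theta,
        measurable_fun setT theta, measurable_fun setT thinv &
        forall B, measurable B -> m (theta @^-1` B) = m B].

Definition meas_matrix (A : X -> nat -> nat -> bool) : Prop :=
  forall i j : nat, measurable_fun setT (fun x => A x i j).

Definition top_mixing (theta : X -> X) (A : X -> nat -> nat -> bool) : Prop :=
  forall a b : nat, exists N : nat, forall n : nat, (N <= n)%N -> forall x : X,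
    exists w : nat -> nat,
      [/\ w 0%N = a, w n.+2 = b &
          forall i : nat, (i < n.+2)%N -> A (iter i theta x) (w i) (w i.+1)].

Definition summable_pot (m : {measure set X -> \bar R}) (theta : X -> X)
  (A : X -> nat -> nat -> bool) (alpha : R) (phi : X -> Seq -> R) : Prop :=
  [/\ measurable_fun (Omega theta A) (fun z => phi z.1 z.2),
      (forall x, cont_on (Efib theta A x) (phi x)),
      ess_sup m (fun x => var_alpha alpha (Efib theta A x) (phi x)) < +oo,
      (forall e : nat, exists c C : R, (0 < c)%R /\ (c < C)%R /\
        \forall x \ae m, forall w, cyl1 theta A x e w ->
          (c <= expR (phi x w))%R /\ (expR (phi x w) <= C)%R)
    & (fun l : nat => ess_sup m (fun x =>
          fsup (Efib theta A (theta x)) (Lpos A phi x (ind_big l)))) @ \oo --> 0 ].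

Definition condA (m : {measure set X -> \bar R}) (theta : X -> X)
  (A : X -> nat -> nat -> bool) (phi : X -> Seq -> R) : Prop :=
  forall e : nat, exists2 M : R, (0 < M)%R &
    \forall x \ae m, forall w, cyl1 theta A (theta x) e w ->
      (M^-1)%:E <= Lpos A phi x (cst 1%R) w.

Definition condB (m : {measure set X -> \bar R}) (theta : X -> X)
  (A : X -> nat -> nat -> bool) (phi : X -> Seq -> R) : Prop :=
  (fun e : nat => ess_sup m (fun x =>
      fsup (cyl1 theta A (theta x) e) (Lpos A phi x (cst 1%R)))) @ \oo --> 0.

Definition condC (m : {measure set X -> \bar R}) (theta : X -> X)
  (A : X -> nat -> nat -> bool) (phi : X -> Seq -> R) (kappa : R) (F : set nat) : Prop :=
  [/\ (0 < kappa)%R, (kappa < 4^-1)%R, finite_set F &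
      \forall x \ae m,
        fsup (Efib theta A (theta x)) (Lpos A phi x (ind_notin F))
        <= kappa%:E * finf (cylF theta A (theta x) F) (Lpos A phi x (cst 1%R))].

Definition fine_pot (m : {measure set X -> \bar R}) (theta : X -> X)
  (A : X -> nat -> nat -> bool) (alpha : R) (phi : X -> Seq -> R)
  (kappa : R) (F : set nat) : Prop :=
  [/\ summable_pot m theta A alpha phi, condA m theta A phi,
      condB m theta A phi & condC m theta A phi kappa F].

(* nu (given by its disintegration x |-> nu_x, a probability kernel) is a
   random measure: nu_x lives on E_x^infty *)
Definition random_measure (m : {measure set X -> \bar R}) (theta : X -> X)
  (A : X -> nat -> nat -> bool) (nu : X -> {measure set Seq -> \bar R}) : Prop :=
  \forall x \ae m, nu x (Efib theta A x) = 1.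

Definition conformal (m : {measure set X -> \bar R}) (theta : X -> X)
  (A : X -> nat -> nat -> bool) (phi : X -> Seq -> R) (F : set nat)
  (nu : X -> {measure set Seq -> \bar R}) (lam : X -> R) : Prop :=
  [/\ random_measure m theta A nu,
      measurable_fun setT lam /\ (forall x, (0 < lam x)%R),
      ess_sup m (fun x => (`|ln (lam x)|)%:E) < +oo,
      (\forall x \ae m, forall g : Seq -> R,
        cont_on (Efib theta A x) g -> sup_norm (Efib theta A x) g < +oo ->
        \int[nu (theta x)]_(w in Efib theta A (theta x)) (Lop A phi x g w)%:E
        = (lam x)%:E * \int[nu x]_(w in Efib theta A x) (g w)%:E)
    & \forall x \ae m, (2^-1)%:E <= nu x (cylF theta A x F)].

Definition in_Hq (m : {measure set X -> \bar R}) (theta : X -> X)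
  (A : X -> nat -> nat -> bool) (alpha : R) (q : \bar R) (h : X -> Seq -> R) : Prop :=
  [/\ measurable_fun (Omega theta A) (fun z => h z.1 z.2),
      (\forall x \ae m, Holder alpha (Efib theta A x) (h x)) &
      in_Lp m q (fun x => holder_norm alpha (Efib theta A x) (h x))].

Definition Hq_norm (m : {measure set X -> \bar R}) (theta : X -> X)
  (A : X -> nat -> nat -> bool) (alpha : R) (q : \bar R) (h : X -> Seq -> R) : \bar R :=
  Lnorm m q (fun x => (holder_norm alpha (Efib theta A x) (h x))%:E).

Definition density (m : {measure set X -> \bar R}) (theta : X -> X)
  (A : X -> nat -> nat -> bool) (alpha : R) (phi : X -> Seq -> R)
  (nu : X -> {measure set Seq -> \bar R}) (lam : X -> R) (rho : X -> Seq -> R) : Prop :=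
  [/\ in_Hq m theta A alpha +oo rho,
      (\forall x \ae m, forall w, Efib theta A x w -> (0 < rho x w)%R),
      (\forall x \ae m, \int[nu x]_(w in Efib theta A x) (rho x w)%:E = 1) &
      \forall x \ae m, forall w, Efib theta A (theta x) w ->
        ((lam x)^-1 * Lop A phi x (rho x) w)%R = rho (theta x) w].

Definition L1fib (theta : X -> X) (A : X -> nat -> nat -> bool)
  (nu : X -> {measure set Seq -> \bar R}) (g : X -> Seq -> R) (x : X) : R :=
  fine (\int[nu x]_(w in Efib theta A x) (`|g x w|)%:E).

Definition in_L1p (m : {measure set X -> \bar R}) (theta : X -> X)
  (A : X -> nat -> nat -> bool) (nu : X -> {measure set Seq -> \bar R})
  (p : \bar R) (g : X -> Seq -> R) : Prop :=
  [/\ measurable_fun (Omega theta A) (fun z => g z.1 z.2),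
      (\forall x \ae m, (nu x).-integrable (Efib theta A x) (EFin \o g x)) &
      in_Lp m p (L1fib theta A nu g)].

Definition L1p_norm (m : {measure set X -> \bar R}) (theta : X -> X)
  (A : X -> nat -> nat -> bool) (nu : X -> {measure set Seq -> \bar R})
  (p : \bar R) (g : X -> Seq -> R) : \bar R :=
  Lnorm m p (fun x => (L1fib theta A nu g x)%:E).

End Fibres.

(* Main.v *)
(** Discarding the null sets, everything happens along the orbits of a forward
    invariant set [G], with constants independent of the base point.  Let
    [P = lam^-1 L] be the normalised fibre operator and let cone [H] be the set of
    nonnegative [f] with [f t <= exp (H d(t,w)^alpha) f w] when [t 0 = w 0]; the
    Hölder bound on [phi] makes [P] contract [H] towards a fixed constant.
    - Condition (B) bounds the symbols which may follow a given symbol, because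
      mixing makes every cylinder nonempty.  Hence the words provided by mixing
      use boundedly many symbols, and [P^n] of a function which is at least [s] on
      [[e]] is at least a uniform constant times [s] on [[b]].
    - Summability makes [P (ind_big l)] and [nu_x [0..l]^c] uniformly small.  With
      the lower bound on the mass of finitely many cylinders, this keeps
      [sup f <= K int f dnu_x] along the iteration.
    - So after [N] steps [P^N f] dominates [2 delta (int f) 1_[0]].  Subtracting
      [delta (int f) 1_[0]] leaves a function of the same class with a smaller
      integral, the same for any two functions of equal integral.  By iteration,
      two such functions get exponentially close in sup norm.
    A Hölder function [f = h rho] of zero integral is the difference of [f + 2 S]
    and [2 S].  Conformality transports [int (g o sigma^n) f dnu_x] to
    [int g (P^n f) dnu_(theta^n x)], first for clopen indicators [g], then by
    uniqueness of measures; Hölder's inequality on [X] concludes. *)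
Require Import Defs.
From HB Require Import structures.
From mathcomp Require Import all_boot all_order all_algebra.
From mathcomp Require Import all_classical all_reals all_analysis.
From mathcomp Require Import ess_sup_inf measurable_realfun.
From mathcomp Require Import lra ring.
Import Order.TTheory GRing.Theory Num.Theory.
Import numFieldNormedType.Exports.
Local Open Scope classical_set_scope.
Local Open Scope ring_scope.
Set Implicit Arguments.
Unset Strict Implicit.
Unset Printing Implicit Defensive.

(** * Sequences: common initial segments, prefixing and shifting *)

Definition agree (n : nat) (w t : nat -> nat) : Prop :=
  forall i, (i < n)%N -> w i = t i.

Lemma agree_sym {n w t} : agree n w t -> agree n t w.
Proof. by move=> h i /h. Qed.

Lemma agree_trans {n w t u} : agree n w t -> agree n t u -> agree n w u.
Proof. by move=> h k i ilt; rewrite (h i ilt) (k i ilt). Qed.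

Lemma agreeW {m n w t} : (m <= n)%N -> agree n w t -> agree m w t.
Proof. by move=> mn h i im; apply: h; exact: leq_trans im mn. Qed.

Lemma agree_scons n e w t : agree n w t -> agree n.+1 (scons e w) (scons e t).
Proof. by move=> h [|i] //=; rewrite ltnS => /h. Qed.

Lemma scons_shift1 (w : nat -> nat) : scons (w 0%N) (shiftn 1 w) = w.
Proof. by apply/funext => -[|i] //=; rewrite /shiftn addn1. Qed.

Lemma shiftn_scons n e (w : nat -> nat) : shiftn n.+1 (scons e w) = shiftn n w.
Proof. by apply/funext => i; rewrite /shiftn addnS. Qed.

Lemma shiftnS n (w : nat -> nat) : shiftn n.+1 w = shiftn n (shiftn 1 w).
Proof. by apply/funext => i; rewrite /shiftn addn1 addnS. Qed.

Lemma shiftn0 (w : nat -> nat) : shiftn 0 w = w.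
Proof. by apply/funext => i; rewrite /shiftn addn0. Qed.

Lemma agree_shiftn k n (w t : nat -> nat) :
  agree (k + n) w t -> agree k (shiftn n w) (shiftn n t).
Proof. by move=> h i ik; rewrite /shiftn h// ltn_add2r. Qed.

(** * The metric on sequences and Hölder bounds *)

Section SeqDist.
Context {R : realType}.
Implicit Types w t : nat -> nat.

Lemma seq_dist_first n w t : agree n w t -> w n <> t n ->
  seq_dist w t = expR (- n%:R) :> R.
Proof.
move=> wt wtn; rewrite /seq_dist; case: pselect => [H|]; last by case; exists n.
case: ex_minnP => k /eqP wtk kmin; congr (expR (- _%:R)).
apply/eqP; rewrite eqn_leq kmin ?andTb; last exact/eqP.
by rewrite leqNgt; apply/negP => /wt.
Qed.

Lemma seq_distxx w : seq_dist w w = 0 :> R.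
Proof. by rewrite /seq_dist; case: pselect => // -[]. Qed.

Lemma neq_agree w t : w <> t -> exists2 n, agree n w t & w n <> t n.
Proof.
move=> wt; have H : exists n, w n != t n.
  apply: contrapT => /forallNP h; apply: wt; apply/funext => i.
  by have /negP := h i; rewrite negbK => /eqP.
case: (ex_minnP H) => n /eqP wtn nmin; exists n => // i.
by rewrite ltnNge => /negP ni; apply: contrapT => /eqP /nmin.
Qed.

Lemma seq_dist_ge0 w t : 0 <= seq_dist w t :> R.
Proof. by rewrite /seq_dist; case: pselect => // ?; rewrite expR_ge0. Qed.

Lemma seq_dist_agree n w t : agree n w t -> seq_dist w t <= expR (- n%:R) :> R.
Proof.
have [->|wt] := pselect (w = t); first by rewrite seq_distxx expR_ge0.
have [k wtk wtnk wtn] := neq_agree wt.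
rewrite (seq_dist_first wtk wtnk) ler_expR lerN2 ler_nat leqNgt.
by apply/negP => /wtn.
Qed.

Lemma seq_dist_le1 w t : seq_dist w t <= 1 :> R.
Proof. by rewrite -expR0 -oppr0; exact: (@seq_dist_agree 0). Qed.

(** Nonzero distances are powers [exp (-k)], where [k] is the first index of disagreement. A
    distance strictly below [exp (-n)] therefore leaves [n.+1] common symbols, not only [n]. *)
Lemma agree_seq_dist n w t : seq_dist w t < expR (- n%:R) :> R -> agree n.+1 w t.
Proof.
have [->//|wt] := pselect (w = t).
have [k wtk wtnk] := neq_agree wt.
rewrite (seq_dist_first wtk wtnk) ltr_expR ltrN2 ltr_nat => nk i ilt.
by apply: wtk; exact: leq_trans ilt nk.
Qed.

Lemma seq_dist_scons e w t :
  seq_dist (scons e w) (scons e t) = expR (-1) * seq_dist w t :> R.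
Proof.
have [->|wt] := pselect (w = t); first by rewrite !seq_distxx mulr0.
have [k wtk wtnk] := neq_agree wt.
rewrite (seq_dist_first wtk wtnk) (seq_dist_first (agree_scons e wtk))//.
by rewrite -expRD -opprD -natr1 addrC.
Qed.

(** Balls of the metric are cylinders, so continuity can be tested on initial segments instead of
    real radii. *)
Lemma cont_onP (D : set Seq) (g : Seq -> R) :
  cont_on D g <-> (forall w, D w -> forall eps : R, 0 < eps ->
    exists n, forall t, D t -> agree n w t -> `|g t - g w| < eps).
Proof.
split=> h w Dw eps eps0; have := h w Dw eps eps0.
- move=> [de de0 hde].
  have [n _ hn] : \forall n \near \oo, expR (- n%:R) < de.
    have := @cvgn_expR R; move/cvgrPdist_lt => /(_ de de0).
    by apply: filterS => n; rewrite sub0r normrN ger0_norm// expR_ge0.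
  exists n => t Dt wt; apply: hde => //.
  by apply: le_lt_trans (seq_dist_agree wt) (hn n _) => /=.
- move=> [n hn]; exists (expR (- n%:R)); first exact: expR_gt0.
  by move=> t Dt /agree_seq_dist /(agreeW (leqnSn n)); exact: hn.
Qed.

Section Power.
Variable alpha : R.
Hypothesis alpha0 : 0 < alpha.
Let q := expR (- alpha).

Lemma seq_dist_pow_scons e w t :
  seq_dist (scons e w) (scons e t) `^ alpha = q * seq_dist w t `^ alpha.
Proof.
rewrite seq_dist_scons powRM ?expR_ge0 ?seq_dist_ge0//.
by rewrite -expRM mulN1r.
Qed.

Lemma seq_dist_pow_le1 w t : seq_dist w t `^ alpha <= 1.
Proof.
apply: (@le_trans _ _ (1 `^ alpha)); last by rewrite powR1.
by apply: ge0_ler_powR; rewrite ?nnegrE ?seq_dist_ge0 ?seq_dist_le1 ?ler01 ?ltW.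
Qed.

Lemma seq_dist_pow_agree n w t : agree n w t -> seq_dist w t `^ alpha <= q ^+ n.
Proof.
move=> /seq_dist_agree h.
rewrite /q -expRM_natl mulrN -mulNr expRM.
apply: ge0_ler_powR; rewrite ?nnegrE ?seq_dist_ge0 ?expR_ge0 //.
exact: ltW.
Qed.

Lemma var_alpha_dist (D : set Seq) (g : Seq -> R) (v : R) :
  (var_alpha alpha D g <= v%:E)%E ->
  forall t w, D t -> D w -> t 0%N = w 0%N ->
  `|g t - g w| <= v * seq_dist t w `^ alpha.
Proof.
move=> hv t w Dt Dw tw0.
have [->|tw] := pselect (t = w).
  rewrite subrr normr0 seq_distxx mulr_ge0 ?powR_ge0//.
  by rewrite -lee_fin (le_trans _ hv)//; apply: ereal_sup_ubound; left.
have dpos : 0 < seq_dist t w :> R.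
  have [k twk twnk] := neq_agree tw.
  by rewrite (seq_dist_first twk twnk) expR_gt0.
rewrite -ler_pdivrMr ?powR_gt0// -lee_fin (le_trans _ hv)//.
by apply: ereal_sup_ubound; right; exists t, w.
Qed.

Lemma sup_norm_bound (D : set Seq) (g : Seq -> R) (s : R) :
  (sup_norm D g <= s%:E)%E -> forall w, D w -> `|g w| <= s.
Proof.
move=> hs w Dw; rewrite -lee_fin (le_trans _ hs)//.
by apply: ereal_sup_ubound; right; exists w.
Qed.

Lemma sup_norm_lty (D : set Seq) (g : Seq -> R) (s : R) : 0 <= s ->
  (forall w, D w -> `|g w| <= s) -> (sup_norm D g < +oo)%E.
Proof.
move=> s0 hs; apply: (@le_lt_trans _ _ s%:E); last exact: ltry.
apply: ge_ereal_sup => _ [->|[w Dw <-]]; rewrite lee_fin//.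
exact: hs.
Qed.

Lemma sup_norm_ge0 (D : set Seq) (g : Seq -> R) : (0 <= sup_norm D g)%E.
Proof. by apply: ereal_sup_ubound; left. Qed.

Lemma var_alpha_ge0 (D : set Seq) (g : Seq -> R) : (0 <= var_alpha alpha D g)%E.
Proof. by apply: ereal_sup_ubound; left. Qed.

Lemma holder_norm_ge0 (D : set Seq) (g : Seq -> R) : 0 <= holder_norm alpha D g.
Proof. by rewrite fine_ge0// adde_ge0// ?sup_norm_ge0 ?var_alpha_ge0. Qed.

Lemma holderP (D : set Seq) (g : Seq -> R) : Holder alpha D g ->
  exists s v, [/\ 0 <= s, 0 <= v, holder_norm alpha D g = s + v,
    forall w, D w -> `|g w| <= s &
    forall t w, D t -> D w -> t 0%N = w 0%N ->
      `|g t - g w| <= v * seq_dist t w `^ alpha].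
Proof.
move=> [_ gs gv]; have s0 := sup_norm_ge0 D g; have v0 := var_alpha_ge0 D g.
have fs : sup_norm D g \is a fin_num by rewrite ge0_fin_numE.
have fv : var_alpha alpha D g \is a fin_num by rewrite ge0_fin_numE.
exists (fine (sup_norm D g)), (fine (var_alpha alpha D g)); split.
- exact: fine_ge0.
- exact: fine_ge0.
- by rewrite /holder_norm fineD.
- by apply: sup_norm_bound; rewrite fineK.
- by apply: var_alpha_dist; rewrite fineK.
Qed.

(** Write [f t g t - f w g w = (f t - f w) g t + f w (g t - g w)]. The same constant [S] controls
    the supremum and the variation, which is the form of input taken by the decay estimate. *)
Lemma holderM (D : set Seq) (f g : Seq -> R) :
  Holder alpha D f -> Holder alpha D g ->
  let S := holder_norm alpha D f * holder_norm alpha D g in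
  (forall w, D w -> `|f w * g w| <= S) /\
  (forall t w, D t -> D w -> t 0%N = w 0%N ->
      `|f t * g t - f w * g w| <= S * seq_dist t w `^ alpha).
Proof.
move=> /holderP [s [v [s0 v0 -> hs hv]]] /holderP [s' [v' [s'0 v'0 -> hs' hv']]].
split=> [w Dw|t w Dt Dw tw].
  rewrite normrM ler_pM//.
  - by rewrite (le_trans (hs _ Dw))// lerDl.
  - by rewrite (le_trans (hs' _ Dw))// lerDl.
have -> : f t * g t - f w * g w = (f t - f w) * g t + f w * (g t - g w).
  by rewrite mulrBl mulrBr addrA subrK.
rewrite (le_trans (ler_normD _ _))// !normrM.
set z := seq_dist t w `^ alpha.
have z0 : 0 <= z by exact: powR_ge0.
apply: (@le_trans _ _ ((v * z) * s' + s * (v' * z))).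
  by rewrite lerD// ler_pM// ?hv ?hv' ?hs ?hs'.
have -> : (s + v) * (s' + v') * z = v * z * s' + s * (v' * z) + (s * s' * z + v * v' * z).
  by rewrite mulrDl !mulrDr !mulrDl; lra.
by rewrite lerDl addr_ge0// !mulr_ge0.
Qed.

End Power.
End SeqDist.

(** * The fibre transfer operator *)

Definition bounded_by {R : realType} (D : set Seq) (f : Seq -> R) (M : R) : Prop :=
  forall w, D w -> `|f w| <= M.

Section TransferOperator.
Context {R : realType} {d : measure_display} {X : measurableType d}.
Variables (theta : X -> X) (A : X -> nat -> nat -> bool) (phi : X -> Seq -> R).
Local Notation E := (Efib theta A).
Implicit Types (x : X) (w t : Seq) (f g : Seq -> R).

Lemma Efib_scons x e w : E x (scons e w) <-> A x e (w 0%N) /\ E (theta x) w.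
Proof.
split=> [h|[h0 h] [|i]//=].
  by split; [exact: (h 0%N)|move=> i; have := h i.+1; rewrite iterSr].
by have := h i; rewrite -iterSr iterS.
Qed.

Lemma Efib_shift1 x w : E x w -> E (theta x) (shiftn 1 w).
Proof. by rewrite -{1}(scons_shift1 w) => /Efib_scons[]. Qed.

Lemma Efib_shiftn n x w : E x w -> E (iter n theta x) (shiftn n w).
Proof.
elim: n x w => [|n IH] x w Exw; first by rewrite shiftn0.
by rewrite iterSr shiftnS; exact/IH/Efib_shift1.
Qed.

Lemma Lterm_eq x w f g : E (theta x) w -> (forall t, E x t -> f t = g t) ->
  Lterm A phi x f w = Lterm A phi x g w.
Proof.
move=> Ew fg; apply/funext => e; rewrite /Lterm; case: ifP => // h.
by rewrite fg//; exact/Efib_scons.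
Qed.

Lemma Lop_eq x w f g : E (theta x) w -> (forall t, E x t -> f t = g t) ->
  Lop A phi x f w = Lop A phi x g w.
Proof. by move=> Ew fg; rewrite /Lop (Lterm_eq Ew fg). Qed.

Lemma Lterm_le x w f g : E (theta x) w -> (forall t, E x t -> f t <= g t) ->
  forall e, Lterm A phi x f w e <= Lterm A phi x g w e.
Proof.
move=> Ew fg e; rewrite /Lterm; case: ifP => // h.
by rewrite ler_wpM2r ?expR_ge0// fg//; exact/Efib_scons.
Qed.

Lemma Lterm_ge0 x w f : E (theta x) w -> (forall t, E x t -> 0 <= f t) ->
  forall e, 0 <= Lterm A phi x f w e.
Proof.
move=> Ew f0 e; rewrite /Lterm; case: ifP => // h.
by rewrite mulr_ge0 ?expR_ge0// f0//; exact/Efib_scons.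
Qed.

Lemma series_Lterm_le x w f : E (theta x) w -> (forall t, E x t -> 0 <= f t) ->
  forall n, ((series (Lterm A phi x f w) n)%:E <= Lpos A phi x f w)%E.
Proof.
move=> Ew f0 n; rewrite /series/= -sumEFin; apply: nneseries_lim_ge => k _ _.
by rewrite lee_fin Lterm_ge0.
Qed.

Lemma nondecreasing_series_Lterm x w f : E (theta x) w ->
  (forall t, E x t -> 0 <= f t) -> nondecreasing_seq (series (Lterm A phi x f w)).
Proof. by move=> Ew f0; apply: nondecreasing_series => k _ _; exact: Lterm_ge0. Qed.

(** [Lop] is a limit of real partial sums and is meaningful only when they converge. For nonnegative
    [f] they increase, so a finite bound on the extended sum [Lpos] gives convergence and bounds the
    limit at once. *)
Lemma Lpos_le x w f (D : R) : E (theta x) w -> (forall t, E x t -> 0 <= f t) ->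
  (Lpos A phi x f w <= D%:E)%E ->
  cvgn (series (Lterm A phi x f w)) /\ Lop A phi x f w <= D.
Proof.
move=> Ew f0 hD.
have le n : series (Lterm A phi x f w) n <= D.
  by rewrite -lee_fin (le_trans _ hD)// series_Lterm_le.
have cv : cvgn (series (Lterm A phi x f w)).
  apply: nondecreasing_is_cvgn; first exact: nondecreasing_series_Lterm.
  by exists D => _ [n _ <-].
by split=> //; apply: limr_le => //; exact: nearW.
Qed.

Section Summable.
Variables (x : X) (w : Seq) (D : R).
Hypotheses (Ew : E (theta x) w) (hD : (Lpos A phi x (cst 1%R) w <= D%:E)%E).

(** The terms are dominated by [M] times those for the constant 1, whose sum is finite by [hD]. *)
Lemma is_cvg_Lop f M : bounded_by (E x) f M -> cvgn (series (Lterm A phi x f w)).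
Proof.
move=> fM; apply: normed_cvg.
have f1 : forall t, E x t -> 0 <= (cst 1%R : Seq -> R) t by move=> ? _ /=.
have [cv1 _] := Lpos_le Ew f1 hD.
apply: (@series_le_cvg _ _ (fun e => M * Lterm A phi x (cst 1%R) w e)).
- by move=> n; exact: normr_ge0.
- move=> n; rewrite /Lterm; case: ifP => h; last by rewrite mulr0.
  have Ht : E x (scons n w) by apply/Efib_scons.
  by rewrite !mulr_ge0 ?expR_ge0 ?ler01// (le_trans _ (fM _ Ht)).
- move=> n; rewrite /Lterm /=; case: ifP => h; last by rewrite normr0 mulr0.
  have Ht : E x (scons n w) by apply/Efib_scons.
  rewrite normrM (ger0_norm (expR_ge0 _)) mul1r.
  by rewrite ler_wpM2r ?expR_ge0// fM.
- by have /is_cvg_seriesZ := cv1; apply.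
Qed.

Lemma LopD f g M M' : bounded_by (E x) f M -> bounded_by (E x) g M' ->
  Lop A phi x (fun t => f t + g t) w = Lop A phi x f w + Lop A phi x g w.
Proof.
move=> fM gM; rewrite /Lop -lim_seriesD; [|exact: is_cvg_Lop fM|exact: is_cvg_Lop gM].
congr (limn (series _)); apply/funext => e; rewrite fctE /Lterm.
by case: ifP; rewrite ?addr0// mulrDl.
Qed.

Lemma LopZ f (k M : R) : bounded_by (E x) f M ->
  Lop A phi x (fun t => k * f t) w = k * Lop A phi x f w.
Proof.
move=> fM; rewrite /Lop -[RHS]lim_seriesZ; last exact: is_cvg_Lop fM.
congr (limn (series _)); apply/funext => e.
rewrite -[RHS]/(k * Lterm A phi x f w e) /Lterm.
by case: ifP; rewrite ?mulr0// -mulrA.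
Qed.

Lemma Lop_le f g M M' : bounded_by (E x) f M -> bounded_by (E x) g M' ->
  (forall t, E x t -> f t <= g t) -> Lop A phi x f w <= Lop A phi x g w.
Proof.
move=> fM gM fg; apply: lim_series_le => [||n]; [exact: is_cvg_Lop fM|exact: is_cvg_Lop gM|].
exact: Lterm_le.
Qed.

Lemma Lop_ge_term f M e : bounded_by (E x) f M -> (forall t, E x t -> 0 <= f t) ->
  A x e (w 0%N) -> f (scons e w) * expR (phi x (scons e w)) <= Lop A phi x f w.
Proof.
move=> fM f0 h.
apply: (@le_trans _ _ (series (Lterm A phi x f w) e.+1)); last first.
  by apply: nondecreasing_cvgn_le; [exact: nondecreasing_series_Lterm|exact: is_cvg_Lop fM].
rewrite seriesSr {2}/Lterm h lerDr /series/= sumr_ge0// => k _.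
exact: Lterm_ge0.
Qed.

End Summable.

End TransferOperator.

(** * Cones of functions with Hölder logarithm *)

Section Cone.
Context {R : realType}.
Variable alpha : R.
Hypothesis alpha0 : 0 < alpha.
Implicit Types (H : R) (D : set Seq) (f : Seq -> R).

(** For positive [f] this says that [log f] is Hölder with constant [H] on each one-symbol cylinder.
    The multiplicative form also admits functions that vanish on whole cylinders, such as
    [ind_eq e]. *)
Definition cone H D f : Prop :=
  (forall w, D w -> 0 <= f w) /\
  (forall t w, D t -> D w -> t 0%N = w 0%N ->
     f t <= expR (H * seq_dist t w `^ alpha) * f w).

Lemma coneW H H' D f : H <= H' -> cone H D f -> cone H' D f.
Proof.
move=> HH' [f0 Hf]; split=> // t w Dt Dw tw; apply: (le_trans (Hf t w Dt Dw tw)).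
by rewrite ler_wpM2r ?f0// ler_expR ler_wpM2r ?powR_ge0.
Qed.

Lemma cone_le H D f : 0 <= H -> cone H D f ->
  forall t w, D t -> D w -> t 0%N = w 0%N -> f t <= expR H * f w.
Proof.
move=> H0 [f0 Hf] t w Dt Dw tw; apply: (le_trans (Hf t w Dt Dw tw)).
by rewrite ler_wpM2r ?f0// ler_expR ler_piMr ?seq_dist_pow_le1.
Qed.

Lemma cone_cst H D (k : R) : 0 <= H -> 0 <= k -> cone H D (fun=> k).
Proof.
move=> H0 k0; split=> // t w _ _ _.
by rewrite ler_peMl// -expR0 ler_expR mulr_ge0 ?powR_ge0.
Qed.

Definition ind_eq (e : nat) : Seq -> R := fun t => if t 0%N == e then 1 else 0.

Lemma cone_ind_eq H D e : 0 <= H -> cone H D (ind_eq e).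
Proof.
move=> H0; split=> [w _|t w _ _ tw]; rewrite /ind_eq; first by case: ifP.
by rewrite tw ler_peMl//; [case: ifP|rewrite -expR0 ler_expR mulr_ge0 ?powR_ge0].
Qed.

Lemma cone_ind_big H D l : 0 <= H -> cone H D (ind_big l).
Proof.
move=> H0; split=> [w _|t w _ _ tw]; rewrite /ind_big; first by case: ifP.
by rewrite tw ler_peMl//; [case: ifP|rewrite -expR0 ler_expR mulr_ge0 ?powR_ge0].
Qed.

Lemma cvg_expR_geometric (H : R) :
  expR (H * expR (- alpha) ^+ n) @[n --> \oo] --> (1 : R).
Proof.
rewrite -[X in _ --> X]expR0; apply: continuous_cvg; first exact: continuous_expR.
rewrite -[X in _ --> X](mulr0 H); apply: cvgM; [exact: cvg_cst|apply: cvg_expr].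
by rewrite ger0_norm ?expR_ge0// expR_lt1 oppr_lt0.
Qed.

Lemma cone_cont H D f : 0 <= H -> cone H D f -> cont_on D f.
Proof.
move=> H0 cf; apply/cont_onP => w Dw eps eps0.
have f0 := cf.1 _ Dw.
(* [M] bounds [f] on the one-symbol cylinder of [w]; the added 1 makes it positive. Agreement on
   [n >= 1] symbols puts [f t] and [f w] within a factor [B] of each other, so they differ by at
   most [(B - 1) M]. *)
pose M := expR H * f w + 1.
have M0 : 0 < M by rewrite ltr_wpDl// mulr_ge0 ?expR_ge0.
have /cvgrPdist_lt /(_ (eps / M)) := @cvg_expR_geometric H.
rewrite divr_gt0// => /(_ isT) [N _ hN].
pose n := N.+1; exists n => t Dt wt.
set B := expR (H * expR (- alpha) ^+ n).
have B1 : 1 <= B by rewrite -expR0 ler_expR mulr_ge0 ?exprn_ge0 ?expR_ge0.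
have hB : B - 1 < eps / M.
  have /= := hN n (leqnSn N); rewrite distrC ger0_norm// subr_ge0; exact: B1.
have tw0 : t 0%N = w 0%N by rewrite wt.
have ftw : f t <= B * f w.
  rewrite (le_trans (cf.2 _ _ Dt Dw tw0))// ler_wpM2r// ler_expR ler_wpM2l//.
  exact: seq_dist_pow_agree (agree_sym wt).
have fwt : f w <= B * f t.
  rewrite (le_trans (cf.2 _ _ Dw Dt (esym tw0)))// ler_wpM2r ?cf.1// ler_expR ler_wpM2l//.
  exact: seq_dist_pow_agree wt.
have ftM : f t <= M.
  by rewrite (le_trans (cone_le H0 cf Dt Dw tw0))// lerDl.
have fwM : f w <= M.
  by rewrite (le_trans (cone_le H0 cf Dw Dw erefl))// lerDl.
have BM : (B - 1) * M < eps by rewrite -ltr_pdivlMr.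
apply: le_lt_trans BM; rewrite ler_norml; apply/andP; split.
  rewrite lerNl opprB lerBlDr (le_trans fwt)//.
  rewrite -lerBlDr -{2}(mul1r (f t)) -mulrBl ler_wpM2l// subr_ge0//.
rewrite lerBlDr (le_trans ftw)// -lerBlDr -{2}(mul1r (f w)) -mulrBl.
by rewrite ler_wpM2l// subr_ge0.
Qed.

(* With [y = exp (H z / 2)], the claim reads [y u - a <= y^2 (u' - a)], which uses only [2 a <= u']. *)
Lemma cone_sub H D f e (a : R) : 0 <= H -> 0 <= a -> cone (H / 2) D f ->
  (forall w, D w -> w 0%N = e -> 2 * a <= f w) ->
  cone H D (fun t => f t - a * ind_eq e t).
Proof.
move=> H0 a0 cf fa; split=> [w Dw|t w Dt Dw tw]; rewrite /ind_eq.
  case: eqP => [we|_]; last by rewrite mulr0 subr0 cf.1.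
  by have := fa w Dw we; rewrite mulr1 subr_ge0; lra.
rewrite tw; case: eqP => [we|_]; last first.
  rewrite mulr0 !subr0; apply: (coneW _ cf).2 => //.
  by rewrite ler_pdivrMr// ler_peMr// ler1n.
rewrite mulr1; have := cf.2 t w Dt Dw tw; set z := _ `^ _.
have -> : H * z = H / 2 * z + H / 2 * z by lra.
have y1 : 1 <= expR (H / 2 * z) by rewrite -expR0 ler_expR !mulr_ge0// powR_ge0.
rewrite expRD; move: y1 (fa w Dw we); set y := expR _; set u := f w => y1 ua fty.
have h1 : 0 <= (y - 1) * (u - 2 * a) by rewrite mulr_ge0 ?subr_ge0.
have h2 : 0 <= (y - 1) * ((y - 1) * (u - a)).
  by rewrite !mulr_ge0 ?subr_ge0//; lra.
have h3 : y * y * (u - a) = (y - 1) * ((y - 1) * (u - a)) + (2 * y - 1) * (u - a).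
  by lra.
rewrite h3; nra.
Qed.

(** After adding [2 S] the values are at least [S], so an additive variation [S z] becomes a
    relative one of at most [z], and [1 + z <= exp z]. Hence the constant 1, whatever [f] is. *)
Lemma cone_shift D f (S : R) : 0 <= S -> bounded_by D f S ->
  (forall t w, D t -> D w -> t 0%N = w 0%N ->
     `|f t - f w| <= S * seq_dist t w `^ alpha) ->
  cone 1 D (fun t => f t + 2 * S).
Proof.
move=> S0 fS hf.
have lo w : D w -> S <= f w + 2 * S.
  by move=> /fS; rewrite ler_norml => /andP[]; lra.
split=> [w Dw|t w Dt Dw tw]; first by rewrite (le_trans S0)// lo.
rewrite mul1r; have := hf t w Dt Dw tw; set z := _ `^ _ => h.
have z0 : 0 <= z by exact: powR_ge0.
apply: (@le_trans _ _ ((1 + z) * (f w + 2 * S))); last first.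
  by rewrite ler_wpM2r ?expR_ge1Dx// (le_trans S0)// lo.
have h' : f t - f w <= S * z by rewrite (le_trans (ler_norm _)).
have : S * z <= (f w + 2 * S) * z by rewrite ler_wpM2r// lo.
have -> : (1 + z) * (f w + 2 * S) = f w + 2 * S + (f w + 2 * S) * z by lra.
lra.
Qed.

End Cone.

(** * Uniform choices over finitely many symbols *)

Lemma bounded_choice (P : nat -> nat -> Prop) :
  (forall e, exists r, P e r) ->
  (forall e r r', (r <= r')%N -> P e r -> P e r') ->
  forall l, exists r, forall e, (e <= l)%N -> P e r.
Proof.
move=> hP hmon; elim=> [|l [r hr]].
  by have [r hr] := hP 0%N; exists r => e; rewrite leqn0 => /eqP ->.
have [r' hr'] := hP l.+1; exists (maxn r r') => e.
rewrite leq_eqVlt => /predU1P[->|].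
  exact: hmon (leq_maxr _ _) hr'.
by rewrite ltnS => /hr; apply: hmon; exact: leq_maxl.
Qed.

Lemma pos_choice {R : realType} (P : nat -> R -> Prop) :
  (forall e, exists2 c, 0 < c & P e c) ->
  (forall e c c', 0 < c' -> c' <= c -> P e c -> P e c') ->
  forall l, exists2 c, 0 < c & forall e, (e <= l)%N -> P e c.
Proof.
move=> hP hmon; elim=> [|l [c c0 hc]].
  by have [c c0 hc] := hP 0%N; exists c => // e; rewrite leqn0 => /eqP ->.
have [c' c'0 hc'] := hP l.+1.
have m0 : 0 < Num.min c c' by rewrite lt_min c0.
exists (Num.min c c') => // e; rewrite leq_eqVlt => /predU1P[->|].
  by apply: hmon hc' => //; rewrite ge_min lexx orbT.
by rewrite ltnS => /hc; apply: hmon => //; rewrite ge_min lexx.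
Qed.

(** * Iterates of the normalised operator along an orbit *)

Section Iteration.
Context {R : realType} {d : measure_display} {X : measurableType d}.
Variables (theta : X -> X) (A : X -> nat -> nat -> bool) (phi : X -> Seq -> R).
Variable lam : X -> R.
Local Notation E := (Efib theta A).
Implicit Types (x : X) (f g : Seq -> R).

Definition Pop x f (w : Seq) : R := (lam x)^-1 * Lop A phi x f w.

(** The operator cocycle over [theta], unfolded from its first factor: inductions on [n] restart at
    [theta x] with [Pop x f]. *)
Fixpoint Pn (n : nat) x f : Seq -> R :=
  if n is k.+1 then Pn k (theta x) (Pop x f) else f.

Lemma Pn_add m n x f : Pn (m + n) x f = Pn n (iter m theta x) (Pn m x f).
Proof. by elim: m x f => [|m IH] x f //; rewrite addSn iterSr /= IH. Qed.

Lemma Pop_eq x f g : (forall t, E x t -> f t = g t) ->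
  forall w, E (theta x) w -> Pop x f w = Pop x g w.
Proof. by move=> fg w Ew; rewrite /Pop (Lop_eq _ Ew fg). Qed.

Lemma Pn_eq n x f g : (forall t, E x t -> f t = g t) ->
  forall w, E (iter n theta x) w -> Pn n x f w = Pn n x g w.
Proof.
elim: n x f g => [//|n IH] x f g fg w; rewrite iterSr.
by apply: IH => u; exact: Pop_eq.
Qed.

(* [G] is a forward invariant set of full measure on which every almost sure
   bound of the hypotheses holds with constants independent of the point. *)
Variable G : set X.
Hypothesis Gtheta : forall x, G x -> G (theta x).
Variables k1 k2 D0 : R.
Hypotheses (k1_gt0 : 0 < k1) (k2_gt0 : 0 < k2) (D0_ge1 : 1 <= D0).
Hypothesis lam_bounds : forall x, G x -> k1 <= (lam x)^-1 /\ (lam x)^-1 <= k2.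
Hypothesis Lpos1 : forall x, G x -> forall w, E (theta x) w ->
  (Lpos A phi x (cst 1%R) w <= (D0 / k2)%:E)%E.

Lemma G_iter n x : G x -> G (iter n theta x).
Proof. by move=> Gx; elim: n => //= n; exact: Gtheta. Qed.

Lemma lamV_gt0 x : G x -> 0 < (lam x)^-1.
Proof. by move=> /lam_bounds[h _]; exact: lt_le_trans h. Qed.

Lemma D0_ge0 : 0 <= D0.
Proof. by rewrite (le_trans ler01). Qed.

(** The division by [k2] absorbs the largest possible value of [(lam x)^-1]; in particular [Lpos1]
    becomes the bound [D0] for [P 1]. *)
Lemma Pop_le_const x f (M : R) : G x -> 0 <= M -> (forall t, E x t -> 0 <= f t) ->
  (forall w, E (theta x) w -> Lpos A phi x f w <= (M / k2)%:E)%E ->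
  forall w, E (theta x) w -> Pop x f w <= M.
Proof.
move=> Gx M0 f0 hM w Ew.
have [_ h] := Lpos_le Ew f0 (hM _ Ew).
apply: (@le_trans _ _ ((lam x)^-1 * (M / k2))).
  by rewrite ler_wpM2l// ltW// lamV_gt0.
rewrite mulrA ler_pdivrMr// mulrC ler_wpM2l//.
exact: (lam_bounds Gx).2.
Qed.

Definition bdd x f : Prop := exists2 M, 0 <= M & bounded_by (E x) f M.

Lemma bdd_lin x f g (k : R) : bdd x f -> bdd x g -> bdd x (fun t => f t + k * g t).
Proof.
move=> [M M0 fM] [M' M'0 gM]; exists (M + `|k| * M').
  by rewrite addr_ge0// mulr_ge0.
move=> t Et; rewrite (le_trans (ler_normD _ _))// lerD ?fM//.
by rewrite normrM ler_wpM2l// gM.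
Qed.

Lemma bdd_cst x (k : R) : bdd x (fun=> k).
Proof. by exists `|k|. Qed.

Lemma bdd_ge0 x f (s : R) : (forall t, E x t -> 0 <= f t) ->
  (forall t, E x t -> f t <= s) -> bdd x f.
Proof.
move=> f0 fs; exists (Num.max 0 s) => [|t Et]; first by rewrite le_max lexx.
by rewrite ger0_norm ?f0// le_max fs ?orbT.
Qed.

Lemma bdd_ind_eq x e : bdd x (ind_eq e).
Proof. by apply: (@bdd_ge0 _ _ 1) => t _; rewrite /ind_eq; case: ifP. Qed.

Lemma bdd_ind_big x l : bdd x (ind_big l).
Proof. by apply: (@bdd_ge0 _ _ 1) => t _; rewrite /ind_big; case: ifP. Qed.

Lemma Pop_lin x f g (k : R) : G x -> bdd x f -> bdd x g ->
  forall w, E (theta x) w ->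
  Pop x (fun t => f t + k * g t) w = Pop x f w + k * Pop x g w.
Proof.
move=> Gx [M _ fM] [M' _ gM] w Ew; rewrite /Pop.
have kgM : bounded_by (E x) (fun t => k * g t) (`|k| * M').
  by move=> t Et; rewrite normrM ler_wpM2l// gM.
rewrite (LopD Ew (Lpos1 Gx Ew) fM kgM) (LopZ Ew (Lpos1 Gx Ew) _ gM).
by rewrite mulrDr mulrCA.
Qed.

Lemma Pop_le x f g : G x -> bdd x f -> bdd x g -> (forall t, E x t -> f t <= g t) ->
  forall w, E (theta x) w -> Pop x f w <= Pop x g w.
Proof.
move=> Gx [M _ fM] [M' _ gM] fg w Ew.
apply: ler_wpM2l; first exact/ltW/lamV_gt0.
exact: (Lop_le Ew (Lpos1 Gx Ew) fM gM fg).
Qed.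

Lemma Pop_cst x (k : R) : G x -> forall w, E (theta x) w ->
  Pop x (fun=> k) w = k * Pop x (cst 1%R) w.
Proof.
move=> Gx w Ew.
have -> : (fun=> k) = (fun t : Seq => k * (cst 1%R : Seq -> R) t).
  by apply/funext => t /=; rewrite mulr1.
have b1 : bounded_by (E x) (cst 1%R : Seq -> R) 1 by move=> t _; rewrite normr1.
by rewrite /Pop (LopZ Ew (Lpos1 Gx Ew) _ b1) mulrCA.
Qed.

Lemma Pop1_le x : G x -> forall w, E (theta x) w -> Pop x (cst 1%R) w <= D0.
Proof.
move=> Gx; apply: Pop_le_const => //; first exact: D0_ge0.
exact: Lpos1.
Qed.

Lemma Pop_ge0 x f : G x -> bdd x f -> (forall t, E x t -> 0 <= f t) ->
  forall w, E (theta x) w -> 0 <= Pop x f w.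
Proof.
move=> Gx fM f0 w Ew.
by have := Pop_le Gx (bdd_cst x 0) fM f0 Ew; rewrite Pop_cst// mul0r.
Qed.

Lemma Pop_bdd x f : G x -> bdd x f -> bdd (theta x) (Pop x f).
Proof.
move=> Gx fb; have [M M0 fM] := fb.
exists (D0 * M); first by rewrite mulr_ge0// D0_ge0.
move=> w Ew; rewrite ler_norml.
have f1 t : E x t -> f t <= M by move=> /fM; rewrite ler_norml => /andP[].
have f2 t : E x t -> - M <= f t by move=> /fM; rewrite ler_norml => /andP[].
have P1 := Pop1_le Gx Ew.
apply/andP; split.
  apply: le_trans (Pop_le Gx (bdd_cst x (- M)) fb f2 Ew).
  by rewrite Pop_cst// mulNr lerN2 mulrC ler_wpM2r.
apply: (le_trans (Pop_le Gx fb (bdd_cst x M) f1 Ew)).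
by rewrite Pop_cst// mulrC ler_wpM2r.
Qed.

Lemma Pn_bdd n x f : G x -> bdd x f -> bdd (iter n theta x) (Pn n x f).
Proof.
elim: n x f => [//|n IH] x f Gx fb; rewrite iterSr /=.
by apply: IH; [exact: Gtheta|exact: Pop_bdd].
Qed.

Lemma Pn_ge0 n x f : G x -> bdd x f -> (forall t, E x t -> 0 <= f t) ->
  forall w, E (iter n theta x) w -> 0 <= Pn n x f w.
Proof.
elim: n x f => [//|n IH] x f Gx fb f0 w; rewrite iterSr /=.
by apply: IH; [exact: Gtheta|exact: Pop_bdd|exact: Pop_ge0].
Qed.

Lemma Pn_lin n x f g (k : R) : G x -> bdd x f -> bdd x g ->
  forall w, E (iter n theta x) w ->
  Pn n x (fun t => f t + k * g t) w = Pn n x f w + k * Pn n x g w.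
Proof.
elim: n x f g => [//|n IH] x f g Gx fb gb w; rewrite iterSr /= => Ew.
rewrite -IH//; [|exact: Gtheta|exact: Pop_bdd|exact: Pop_bdd].
by apply: Pn_eq => // t Et; exact: Pop_lin.
Qed.

(** * Lower bounds from mixing *)

Variable c : nat -> R.
Hypothesis c_gt0 : forall e, 0 < c e.
Hypothesis phi_lower : forall x, G x -> forall w, E x w -> c (w 0%N) <= expR (phi x w).
Hypothesis followers : forall e, exists r, forall x, G x -> forall e',
  A x e e' -> (e' <= r)%N.
Hypothesis mixing : top_mixing theta A.

(** Induction on the length: symbols up to [B] have followers up to some [r], and [followers] makes
    [r] independent of the base point. *)
Lemma word_bound l n : exists B, forall x, G x -> forall w : nat -> nat,
  (w 0 <= l)%N -> (forall i, (i < n)%N -> A (iter i theta x) (w i) (w i.+1)) ->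
  forall i, (i <= n)%N -> (w i <= B)%N.
Proof.
elim: n => [|n [B hB]]; first by exists l => x _ w wl _ i; rewrite leqn0 => /eqP ->.
have [|r hr] := bounded_choice followers _ B.
  by move=> e r r' rr' h x Gx e' /(h x Gx) /leq_trans; exact.
exists (maxn B r) => x Gx w wl hw.
have hw' : forall i, (i <= n)%N -> (w i <= B)%N.
  by apply: (hB x) => // i ilt; apply: hw; exact: ltnW.
move=> i; rewrite leq_eqVlt => /predU1P[->|]; last first.
  by rewrite ltnS => /hw' /leq_trans; apply; exact: leq_maxl.
apply: leq_trans (leq_maxr _ _).
exact: (hr _ (hw' n (leqnn n)) _ (G_iter n Gx) _ (hw n (ltnSn n))).
Qed.

(** At each step only the preimage lying on the orbit of [w] is kept in the series. Its weight is at
    least [cB] and the normalisation is at least [k1]. *)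
Lemma Pn_ge_word n x f (w : Seq) (cB : R) : G x -> E x w -> bdd x f ->
  (forall t, E x t -> 0 <= f t) -> 0 <= cB ->
  (forall i, (i < n)%N -> cB <= c (w i)) ->
  (k1 * cB) ^+ n * f w <= Pn n x f (shiftn n w).
Proof.
elim: n x f w => [|n IH] x f w Gx Exw fb f0 cB0 hc.
  by rewrite expr0 mul1r shiftn0.
rewrite shiftnS /= exprS -mulrA mulrCA.
apply: le_trans (IH (theta x) (Pop x f) (shiftn 1 w) _ _ _ _ _ _); first last.
- by move=> i ilt; rewrite /shiftn addn1; exact: hc.
- by [].
- exact: Pop_ge0.
- exact: Pop_bdd.
- exact: Efib_shift1.
- exact: Gtheta.
rewrite ler_wpM2l ?exprn_ge0 ?mulr_ge0 ?(ltW k1_gt0)//.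
have Ew1 := Efib_shift1 Exw; have [M _ fM] := fb.
have := Lop_ge_term Ew1 (Lpos1 Gx Ew1) fM f0 (Exw 0%N).
rewrite scons_shift1 => h.
rewrite /Pop -mulrA ler_pM ?(ltW k1_gt0) ?mulr_ge0 ?f0//.
  exact: (lam_bounds Gx).1.
apply: le_trans h; rewrite mulrC ler_wpM2l ?f0//.
by apply: le_trans (phi_lower Gx Exw); exact: hc.
Qed.

Definition concat n (u w : nat -> nat) : nat -> nat :=
  fun i => if (i < n)%N then u i else w (i - n)%N.

Lemma shiftn_concat n u w : shiftn n (concat n u w) = w.
Proof. by apply/funext => i; rewrite /shiftn /concat ltnNge leq_addl/= addnK. Qed.

Lemma Efib_concat n x (u : nat -> nat) (w : Seq) :
  (forall i, (i < n)%N -> A (iter i theta x) (u i) (u i.+1)) ->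
  E (iter n theta x) w -> u n = w 0%N -> E x (concat n u w).
Proof.
move=> hu Ew unw i; rewrite /concat.
have [ltin|leni] := ltnP i n.
  have [_|le] := ltnP i.+1 n; first exact: hu.
  have -> : i.+1 = n by apply/eqP; rewrite eqn_leq ltin.
  by rewrite subnn -unw -(_ : i.+1 = n) ?hu//; apply/eqP; rewrite eqn_leq ltin.
rewrite ltnNge (leqW leni)/= subSn//.
by have := Ew (i - n)%N; rewrite -iterD subnK.
Qed.

(** Mixing provides a word from [e] to [b], and [word_bound] confines its symbols to a finite range
    that does not depend on [x]. The weights [c] have a positive minimum [cB] there, so the constant
    depends on [l] and [n] only. *)
Lemma minorization l : exists n0, forall n, (n0 <= n)%N -> exists2 k : R, 0 < k &
  forall x f (s : R) e b, G x -> bdd x f -> (forall t, E x t -> 0 <= f t) ->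
    0 <= s -> (e <= l)%N -> (b <= l)%N ->
    (forall t, E x t -> t 0%N = e -> s <= f t) ->
    forall w, E (iter n theta x) w -> w 0%N = b -> k * s <= Pn n x f w.
Proof.
pose conn a b N := forall n, (N <= n)%N -> forall x, exists w : nat -> nat,
  [/\ w 0%N = a, w n.+2 = b &
      forall i, (i < n.+2)%N -> A (iter i theta x) (w i) (w i.+1)].
have mono a b N N' : (N <= N')%N -> conn a b N -> conn a b N'.
  by move=> NN' h n N'n; apply: h; exact: leq_trans N'n.
have [||N hN] := @bounded_choice (fun a N => forall b, (b <= l)%N -> conn a b N) _ _ l.
- move=> a; have [//||N hN] := @bounded_choice (conn a) _ _ l.
  + by move=> b; have [N hN] := mixing a b; exists N.
  + by move=> b r r'; exact: mono.
  + by exists N => b; exact: hN.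
- by move=> a r r' rr' h b bl; apply: mono rr' (h b bl).
(* Mixing inserts a word of [n.+1] symbols between [a] and [b], which makes [n.+2] steps; hence the
   shift of the threshold by two. *)
exists N.+2 => -[|[|n]]//; rewrite !ltnS => Nn.
have [B hB] := word_bound l n.+2.
have [||cB cB0 hcB] := @pos_choice R (fun e k => k <= c e) _ _ B.
- by move=> e; exists (c e).
- by move=> e k k' _ kk'; exact: le_trans.
exists ((k1 * cB) ^+ n.+2); first by rewrite exprn_gt0// mulr_gt0.
move=> x f s e b Gx fb f0 s0 el bl fs w Ew wb.
(* Glued before [w], the word [u] gives a point of the cylinder of [e] whose shift by [n.+2] is
   [w]. *)
have [u [u0 un hu]] := hN e el b bl n Nn x.
have Ev := Efib_concat hu Ew (etrans un (esym wb)).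
rewrite -(shiftn_concat n.+2 u w).
apply: le_trans (Pn_ge_word Gx Ev fb f0 (ltW cB0) _); last first.
  move=> i ilt; rewrite /concat ilt; apply: hcB.
  by apply: (hB x) => //; [rewrite u0|exact: ltnW].
rewrite ler_wpM2l ?exprn_ge0 ?mulr_ge0 ?(ltW k1_gt0) ?(ltW cB0)//.
exact: fs.
Qed.


(** * Contraction of the cones *)

Variables (alpha V : R).
Hypotheses (alpha0 : 0 < alpha) (V_ge0 : 0 <= V).
Hypothesis phi_holder : forall x, G x -> forall t w, E x t -> E x w ->
  t 0%N = w 0%N -> `|phi x t - phi x w| <= V * seq_dist t w `^ alpha.
Local Notation q := (expR (- alpha)).
Local Notation cone := (cone alpha).

Lemma q_ge0 : 0 <= q. Proof. exact: expR_ge0. Qed.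

Lemma q_lt1 : q < 1. Proof. by rewrite expR_lt1 oppr_lt0. Qed.

(** Points with the same first symbol have the same admissible prefixes, and a prefix multiplies the
    distance to the power [alpha] by [q]. Term by term, [f] varies by a factor of at most
    [exp (H q z)] and the weight by at most [exp (V q z)]. *)
Lemma Pop_cone H x f : G x -> bdd x f -> cone H (E x) f ->
  cone (q * (H + V)) (E (theta x)) (Pop x f).
Proof.
move=> Gx fb [f0 fH]; split; first exact: Pop_ge0.
move=> t w Et Ew tw0; set B := expR _.
have [M M0 fM] := fb.
have BfM : bounded_by (E x) (fun u => B * f u) (B * M).
  by move=> u Eu; rewrite normrM ger0_norm ?expR_ge0// ler_wpM2l ?expR_ge0// fM.
rewrite /Pop mulrCA ler_wpM2l ?(ltW (lamV_gt0 Gx))//.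
rewrite -(LopZ Ew (Lpos1 Gx Ew) B fM).
apply: lim_series_le => [||e].
- exact: is_cvg_Lop (Lpos1 Gx Et) _ _ fM.
- exact: is_cvg_Lop (Lpos1 Gx Ew) _ _ BfM.
rewrite /Lterm tw0; case: ifP => // h.
have Eet : E x (scons e t) by apply/Efib_scons; rewrite tw0.
have Eew : E x (scons e w) by apply/Efib_scons.
have := fH _ _ Eet Eew erefl.
have := phi_holder Gx Eet Eew erefl.
rewrite seq_dist_pow_scons; set z := _ `^ _ => hphi hf.
have hphi' : expR (phi x (scons e t)) <= expR (V * (q * z)) * expR (phi x (scons e w)).
  by rewrite -expRD ler_expR -lerBlDr (le_trans (ler_norm _)).
apply: le_trans (ler_pM (f0 _ Eet) (expR_ge0 _) hf hphi') _.
have -> : B = expR (H * (q * z)) * expR (V * (q * z)).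
  by rewrite -expRD; congr expR; rewrite -mulrDl mulrCA mulrA.
by rewrite mulrACA !mulrA.
Qed.

(** The fixed point of the map [H -> q (H + V)] by which [P] acts on cone constants; iterating this
    affine map gives the constant in [Pn_cone]. *)
Local Notation Q := (V * q / (1 - q)).

Lemma Q_ge0 : 0 <= Q.
Proof. by rewrite divr_ge0 ?mulr_ge0 ?q_ge0// subr_ge0 ltW ?q_lt1. Qed.

Lemma QE : Q * (1 - q) = V * q.
Proof. by rewrite divfK// subr_eq0 eq_sym lt_eqF ?q_lt1. Qed.

Lemma Pn_cone n H x f : G x -> bdd x f -> cone H (E x) f ->
  cone (Q * (1 - q ^+ n) + q ^+ n * H) (E (iter n theta x)) (Pn n x f).
Proof.
elim: n H x f => [|n IH] H x f Gx fb fH.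
  by rewrite expr0 subrr mulr0 add0r mul1r.
rewrite iterSr /=.
have := IH _ _ _ (Gtheta Gx) (Pop_bdd Gx fb) (Pop_cone Gx fb fH).
congr cone; rewrite exprSr; move: QE; move: Q => u hu.
have -> : q ^+ n * (q * (H + V)) = q ^+ n * q * H + q ^+ n * (V * q) by ring.
by rewrite -hu; ring.
Qed.

(** The bounded continuous functions on the fibre, those to which conformality applies. *)
Definition adm x f : Prop := cont_on (E x) f /\ bdd x f.

Lemma adm_cone H x f : 0 <= H -> cone H (E x) f -> bdd x f -> adm x f.
Proof. by move=> H0 fH fb; split=> //; exact: cone_cont fH. Qed.

Lemma adm_cst x (k : R) : adm x (fun=> k).
Proof.
split; last exact: bdd_cst.
by move=> w _ eps eps0; exists 1 => // t _ _; rewrite subrr normr0.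
Qed.

Lemma adm_ind_eq x e : adm x (ind_eq e).
Proof. by apply: (adm_cone (lexx 0)); [exact: cone_ind_eq|exact: bdd_ind_eq]. Qed.

Lemma adm_ind_big x l : adm x (ind_big l).
Proof. by apply: (adm_cone (lexx 0)); [exact: cone_ind_big|exact: bdd_ind_big]. Qed.

Lemma adm_lin x f g (k : R) : adm x f -> adm x g -> adm x (fun t => f t + k * g t).
Proof.
move=> [fc fb] [gc gb]; split; last exact: bdd_lin.
apply/cont_onP => w Ew eps eps0.
have k0 : 0 < 2 * (`|k| + 1) by rewrite mulr_gt0// ltr_wpDl.
have [n1 h1] := (cont_onP _ _).1 fc w Ew (eps / 2) (divr_gt0 eps0 (ltr0n _ 2)).
have [n2 h2] := (cont_onP _ _).1 gc w Ew (eps / (2 * (`|k| + 1))) (divr_gt0 eps0 k0).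
exists (maxn n1 n2) => t Et wt.
have {}h1 := h1 t Et (agreeW (leq_maxl _ _) wt).
have {}h2 := h2 t Et (agreeW (leq_maxr _ _) wt).
have -> : f t + k * g t - (f w + k * g w) = (f t - f w) + k * (g t - g w).
  by rewrite mulrBr; lra.
apply: (le_lt_trans (ler_normD _ _)); rewrite [ltRHS](splitr eps) ltr_leD// normrM.
apply: (@le_trans _ _ ((`|k| + 1) * (eps / (2 * (`|k| + 1))))).
  by rewrite ler_pM// ?lerDl// ltW.
have k1' : `|k| + 1 != 0 by rewrite gt_eqF// ltr_wpDl.
by rewrite invfM mulrCA mulrA mulrAC -!mulrA mulVf ?mulr1// mulrC.
Qed.

(** * An abstract invariant family of normalised integrals *)

Variable I : X -> (Seq -> R) -> R.
Hypothesis I_lin : forall x f g (k : R), G x -> adm x f -> adm x g ->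
  I x (fun t => f t + k * g t) = I x f + k * I x g.
Hypothesis I_le : forall x f g, G x -> adm x f -> adm x g ->
  (forall t, E x t -> f t <= g t) -> I x f <= I x g.
Hypothesis I_1 : forall x, G x -> I x (cst 1%R) = 1.
Hypothesis I_Pop : forall x f, G x -> adm x f -> adm (theta x) (Pop x f) ->
  I (theta x) (Pop x f) = I x f.
Hypothesis tail : forall eps : R, 0 < eps -> exists l, forall x, G x ->
  forall w, E (theta x) w -> (Lpos A phi x (ind_big l) w <= eps%:E)%E.

Lemma I_Z x f (k : R) : G x -> adm x f -> I x (fun t => k * f t) = k * I x f.
Proof.
(* Additivity is assumed only for [f + k g]; taking [g = f] and [k - 1] avoids a separate
   computation of the integral of 0. *)
move=> Gx fa; have -> : (fun t => k * f t) = (fun t => f t + (k - 1) * f t).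
  by apply/funext => t; rewrite mulrBl mul1r addrC subrK.
by rewrite I_lin// mulrBl mul1r addrC subrK.
Qed.

Lemma I_cst x (k : R) : G x -> I x (fun=> k) = k.
Proof.
move=> Gx; have -> : (fun=> k) = (fun t : Seq => k * (cst 1%R : Seq -> R) t).
  by apply/funext => t /=; rewrite mulr1.
by rewrite I_Z ?I_1 ?mulr1//; exact: adm_cst.
Qed.

Lemma I_ge0 x f : G x -> adm x f -> (forall t, E x t -> 0 <= f t) -> 0 <= I x f.
Proof.
by move=> Gx fa f0; rewrite -(I_cst 0 Gx); apply: I_le => //; exact: adm_cst.
Qed.

Lemma I_Pop_cone H x f : 0 <= H -> G x -> bdd x f -> cone H (E x) f ->
  I (theta x) (Pop x f) = I x f.
Proof.
move=> H0 Gx fb fH; apply: I_Pop => //; first exact: adm_cone fH fb.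
apply: adm_cone (Pop_cone Gx fb fH) (Pop_bdd Gx fb).
by rewrite mulr_ge0 ?q_ge0 ?addr_ge0.
Qed.

Lemma I_Pn n H x f : 0 <= H -> G x -> bdd x f -> cone H (E x) f ->
  I (iter n theta x) (Pn n x f) = I x f.
Proof.
elim: n H x f => [//|n IH] H x f H0 Gx fb fH; rewrite iterSr /=.
rewrite (IH (q * (H + V))) ?(I_Pop_cone H0)//.
- by rewrite mulr_ge0 ?q_ge0 ?addr_ge0.
- exact: Gtheta.
- exact: Pop_bdd.
- exact: Pop_cone.
Qed.

(** Summability bounds [P (ind_big l)] pointwise. Since [I] is invariant under [P], the integral of
    [ind_big l] at [x] is that of a function bounded by [eps] at [theta x]. *)
Lemma tail_small (eps : R) : 0 < eps -> exists l,
  (forall x, G x -> forall w, E (theta x) w -> Pop x (ind_big l) w <= eps) /\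
  (forall x, G x -> I x (ind_big l) <= eps).
Proof.
move=> eps0; have [l hl] := tail (divr_gt0 eps0 k2_gt0).
have hP x : G x -> forall w, E (theta x) w -> Pop x (ind_big l) w <= eps.
  move=> Gx; apply: Pop_le_const => //; first exact: ltW.
    by move=> t _; rewrite /ind_big; case: ifP.
  exact: hl.
exists l; split=> // x Gx; rewrite -(I_Pop_cone (lexx 0) Gx (bdd_ind_big x l)); last exact: cone_ind_big.
rewrite -(I_cst eps (Gtheta Gx)); apply: I_le => //.
- exact: Gtheta.
- apply: (@adm_cone (q * (0 + V))); first by rewrite mulr_ge0 ?q_ge0 ?add0r.
    by apply: Pop_cone => //; [exact: bdd_ind_big|exact: cone_ind_big].
  by apply: Pop_bdd => //; exact: bdd_ind_big.
- exact: adm_cst.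
- exact: hP.
Qed.

(** Pushing [ind_eq e] forward by [n0] steps keeps its integral. The image is at least [k] on every
    cylinder of a symbol up to [l], and these cylinders together have mass at least one half. *)
Lemma mass_lower l : (forall x, G x -> I x (ind_big l) <= 2^-1) ->
  exists2 c0 : R, 0 < c0 & forall x e, G x -> (e <= l)%N -> c0 <= I x (ind_eq e).
Proof.
move=> hl; have [n0 /(_ n0 (leqnn _)) [k k0 hk]] := minorization l.
exists (k / 2); first by rewrite divr_gt0.
move=> x e Gx el; have Gn := G_iter n0 Gx.
have eb := bdd_ind_eq x e.
have ec := cone_ind_eq alpha (E x) e (lexx (0 : R)).
rewrite -(I_Pn n0 (lexx 0) Gx eb ec).
have a1 : adm (iter n0 theta x) (fun t => 1 + (- 1) * ind_big l t).
  by apply: adm_lin; [exact: adm_cst|exact: adm_ind_big].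
apply: (@le_trans _ _ (I (iter n0 theta x) (fun t => k * (1 + (- 1) * ind_big l t)))).
  rewrite I_Z// ler_wpM2l ?(ltW k0)// I_lin//; [|exact: adm_cst|exact: adm_ind_big].
  by rewrite I_cst// mulN1r; have := hl _ Gn; lra.
have a2 : adm (iter n0 theta x) (fun t => k * (1 + (- 1) * ind_big l t)).
  have -> : (fun t => k * (1 + (- 1) * ind_big l t)) =
            (fun t => 0 + k * (1 + (- 1) * ind_big l t)).
    by apply/funext => t; rewrite add0r.
  by apply: adm_lin => //; exact: adm_cst.
apply: I_le => //.
  by apply: adm_cone (Pn_cone n0 Gx eb ec) (Pn_bdd n0 Gx eb);
    rewrite mulr0 addr0 mulr_ge0 ?Q_ge0// subr_ge0 exprn_ile1 ?q_ge0 ?(ltW q_lt1).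
move=> t Et; have e0 : forall u, E x u -> 0 <= (ind_eq e u : R).
  by move=> u _; rewrite /ind_eq; case: ifP.
rewrite /ind_big; case: ltnP => tl.
  by rewrite mulr1 subrr mulr0; exact: Pn_ge0.
rewrite mulr0 addr0; apply: (hk x (ind_eq e) 1 e (t 0%N)) => //.
by move=> u _ ue; rewrite /ind_eq ue eqxx.
Qed.

(** * A class of functions invariant under the operator *)

Section Class.
Variables (H K c0 : R) (l0 : nat).
Hypotheses (QH : Q <= H) (c0_gt0 : 0 < c0).
Hypothesis l0_Pop : forall x, G x -> forall w, E (theta x) w ->
  Pop x (ind_big l0) w <= 2^-1.
Hypothesis l0_mass : forall x e, G x -> (e <= l0)%N -> c0 <= I x (ind_eq e).
Hypothesis KE : K = 4 * D0 * (expR H / c0).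

Let H_ge0 : 0 <= H. Proof. by rewrite (le_trans Q_ge0). Qed.

Let K_ge0 : 0 <= K.
Proof. by rewrite KE !mulr_ge0 ?D0_ge0 ?expR_ge0// invr_ge0 ltW. Qed.

(** Both conditions are homogeneous, so one class serves functions of every size. The supremum is
    measured against the integral, which [P] preserves. *)
Definition cls x f : Prop :=
  cone H (E x) f /\ forall w, E x w -> f w <= K * I x f.

Lemma cls_bdd x f : cls x f -> bdd x f.
Proof. by move=> [[f0 _] fK]; exact: bdd_ge0 fK. Qed.

Lemma cls_adm x f : cls x f -> adm x f.
Proof. by move=> fc; exact: adm_cone H_ge0 fc.1 (cls_bdd fc). Qed.

Lemma cls_I_ge0 x f : G x -> cls x f -> 0 <= I x f.
Proof. by move=> Gx fc; apply: I_ge0 => //; [exact: cls_adm|exact: fc.1.1]. Qed.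

(** Split at [l0]. On symbols up to [l0], [f] is at most [(exp H / c0) I f], because a cylinder has
    mass at least [c0] and [f] varies on it by a factor of at most [exp H]; this contributes [K / 4]
    by the choice of [K]. Beyond [l0], [f <= K I f] and [P (ind_big l0) <= 1/2] contribute [K / 2].
    The remaining quarter is what permits a later subtraction. *)
Lemma cls_Pop_le x f : G x -> cls x f ->
  forall w, E (theta x) w -> Pop x f w <= 3 / 4 * (K * I x f).
Proof.
move=> Gx fc w Ew; have [fH fK] := fc; have If0 := cls_I_ge0 Gx fc.
pose K0 := expR H / c0.
have K00 : 0 <= K0 by rewrite divr_ge0 ?expR_ge0// ltW.
have small t : E x t -> (t 0 <= l0)%N -> f t <= K0 * I x f.
  move=> Et tl.
  have h : expR (- H) * f t * c0 <= I x f.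
    apply: (@le_trans _ _ (I x (fun u => expR (- H) * f t * ind_eq (t 0%N) u))).
      rewrite I_Z//; last exact: adm_ind_eq.
      by rewrite ler_wpM2l ?mulr_ge0 ?expR_ge0 ?fH.1// l0_mass.
    apply: I_le => //; last 1 first.
    - move=> u Eu; rewrite /ind_eq; case: eqP => [ut|_]; last by rewrite mulr0 fH.1.
      by rewrite mulr1 expRN mulrC ler_pdivrMr ?expR_gt0// mulrC (cone_le _ H_ge0 fH).
    - have := adm_lin (expR (- H) * f t) (adm_cst x 0) (adm_ind_eq x (t 0%N)).
      by congr (adm x _); apply/funext => u; rewrite add0r.
    - exact: cls_adm.
  rewrite /K0 mulrAC ler_pdivlMr//.
  by move: h; rewrite expRN -mulrA mulrC ler_pdivrMr ?expR_gt0// [I x f * _]mulrC.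
have le1 : Pop x f w <= Pop x (fun t => K0 * I x f + K * I x f * ind_big l0 t) w.
  apply: Pop_le => //; [exact: cls_bdd| |].
    by apply: bdd_lin; [exact: bdd_cst|exact: bdd_ind_big].
  move=> t Et; rewrite /ind_big; case: ltnP => tl.
    by rewrite mulr1 (le_trans (fK t Et))// lerDr mulr_ge0.
  by rewrite mulr0 addr0 small.
apply: (le_trans le1); rewrite Pop_lin//; [|exact: bdd_cst|exact: bdd_ind_big].
rewrite Pop_cst//.
have h1 : K0 * I x f * Pop x (cst 1%R) w <= K0 * I x f * D0.
  by apply: ler_wpM2l; [exact: mulr_ge0|exact: Pop1_le].
have h2 : K * I x f * Pop x (ind_big l0) w <= K * I x f * 2^-1.
  by apply: ler_wpM2l; [exact: mulr_ge0|exact: l0_Pop].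
apply: (le_trans (lerD h1 h2)).
have -> : K0 * I x f * D0 = 4^-1 * (K * I x f) by rewrite KE -/K0; field.
lra.
Qed.

Lemma cls_Pop x f : G x -> cls x f -> cls (theta x) (Pop x f).
Proof.
move=> Gx fc; split.
  apply: coneW (Pop_cone Gx (cls_bdd fc) fc.1).
  have : 0 <= (1 - q) * (H - Q) by rewrite mulr_ge0 ?subr_ge0// ltW ?q_lt1.
  by rewrite mulrBr [_ * Q]mulrC QE; lra.
move=> w Ew; rewrite (I_Pop_cone H_ge0 Gx (cls_bdd fc) fc.1).
apply: (le_trans (cls_Pop_le Gx fc Ew)).
have : 0 <= K * I x f by rewrite mulr_ge0// cls_I_ge0.
lra.
Qed.

Lemma cls_Pn n x f : G x -> cls x f -> cls (iter n theta x) (Pn n x f).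
Proof.
elim: n x f => [//|n IH] x f Gx fc; rewrite iterSr /=.
by apply: IH; [exact: Gtheta|exact: cls_Pop].
Qed.

Lemma cls_I_Pn n x f : G x -> cls x f -> I (iter n theta x) (Pn n x f) = I x f.
Proof. by move=> Gx fc; exact: I_Pn H_ge0 Gx (cls_bdd fc) fc.1. Qed.

Lemma cls_PnS_le n x f : G x -> cls x f ->
  forall w, E (iter n.+1 theta x) w -> Pn n.+1 x f w <= 3 / 4 * (K * I x f).
Proof.
move=> Gx fc w Ew; rewrite -addn1 Pn_add -(cls_I_Pn n Gx fc).
by apply: cls_Pop_le => //; [exact: G_iter|exact: cls_Pn].
Qed.

(** The mass of [f] cannot sit mostly on large symbols, so [f] is at least [I f / 2] at a point with
    first symbol at most [l]. The cone spreads this over the cylinder of that symbol, at the cost of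
    [exp (- H)], and minorization carries it to the cylinder of 0. *)
Lemma cls_lower : exists N, exists2 delta : R, 0 < delta & [/\ (0 < N)%N, delta <= 4^-1,
  q ^+ N <= 4^-1 & forall x f, G x -> cls x f -> forall w, E (iter N theta x) w ->
    w 0%N = 0%N -> 2 * (delta * I x f) <= Pn N x f w].
Proof.
(* With this tail mass the part of [f] beyond [l] has integral at most [K I f / (4 (K + 1))], hence
   at most [I f / 4]. *)
have e0 : 0 < (4 * (K + 1))^-1 by rewrite invr_gt0 mulr_gt0// ltr_wpDl.
have [l [_ hl]] := tail_small e0.
have [n0 hn0] := minorization l.
have [n1 _ hn1] : \forall n \near \oo, q ^+ n < 4^-1.
  have /cvgrPdist_lt /(_ 4^-1) : (q ^+ n) @[n --> \oo] --> (0 : R).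
    by apply: cvg_expr; rewrite ger0_norm ?q_ge0// q_lt1.
  rewrite invr_gt0 ltr0n => /(_ isT); apply: filterS => n.
  by rewrite sub0r normrN ger0_norm// exprn_ge0 ?q_ge0.
pose N := (maxn n0 n1).+1.
have [k k0 hk] := hn0 N (leqW (leq_maxl _ _)).
(* Half of the lower bound [k exp (- H) / 2] obtained below per unit of integral: the other half is
   the factor 2 in the conclusion, required by [cone_sub]. *)
pose a := k * expR (- H) / 4.
have a0 : 0 < a by rewrite divr_gt0// mulr_gt0 ?expR_gt0.
exists N, (Num.min 4^-1 a); first by rewrite lt_min invr_gt0 ltr0n a0.
split=> //; first by rewrite ge_min lexx.
  by apply: ltW; apply: hn1 => /=; exact: leqW (leq_maxr _ _).
move=> x f Gx fc w Ew w0; have If0 := cls_I_ge0 Gx fc; have fb := cls_bdd fc.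
apply: (@le_trans _ _ (k * (expR (- H) * (I x f / 2)))).
  have : Num.min 4^-1 a <= a by rewrite ge_min lexx orbT.
  move=> /(ler_wpM2r If0); rewrite /a; lra.
(* The contradiction below, [I f <= 3/4 I f], needs a positive integral; for a zero integral
   nonnegativity suffices. *)
have [I0|] := eqVneq (I x f) 0.
  by rewrite I0 mul0r !mulr0; apply: (Pn_ge0 Gx fb fc.1.1).
move=> /negP In0; have Ipos : 0 < I x f by rewrite lt_neqAle eq_sym If0 andbT; apply/negP.
have [u [Eu ul fu]] : exists u, [/\ E x u, (u 0 <= l)%N & I x f / 2 <= f u].
  apply: contrapT => hno.
  have hf t : E x t -> f t <= I x f / 2 + K * I x f * ind_big l t.
    move=> Et; rewrite /ind_big; case: ltnP => tl.
      by rewrite mulr1 (le_trans (fc.2 t Et))// lerDr divr_ge0.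
    rewrite mulr0 addr0 leNgt; apply/negP => h; apply: hno.
    by exists t; split=> //; exact: ltW.
  have := I_le Gx (cls_adm fc) (adm_lin (K * I x f) (adm_cst x _) (adm_ind_big x l)) hf.
  rewrite I_lin//; [|exact: adm_cst|exact: adm_ind_big].
  rewrite I_cst// => h.
  have h' : K * I x f * I x (ind_big l) <= K * I x f * (4 * (K + 1))^-1.
    by rewrite ler_wpM2l ?mulr_ge0// hl.
  have h'' : K * I x f * (4 * (K + 1))^-1 <= I x f / 4.
    have hK : K * (4 * (K + 1))^-1 <= 4^-1.
      by rewrite ler_pdivrMr; [lra|rewrite mulr_gt0// ltr_wpDl].
    by rewrite mulrAC [leRHS]mulrC ler_wpM2r.
  lra.
apply: (hk x f _ (u 0%N) 0%N) => //.
- exact: fc.1.1.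
- by rewrite mulr_ge0 ?expR_ge0 ?divr_ge0.
move=> t Et tu; rewrite expRN mulrC ler_pdivrMr ?expR_gt0// [leRHS]mulrC.
by apply: (le_trans fu); rewrite (cone_le _ H_ge0 fc.1).
Qed.

(** * Exponential decay by repeated subtraction *)

Section Decay.
Variables (N : nat) (delta : R).
Hypotheses (N_gt0 : (0 < N)%N) (delta_gt0 : 0 < delta) (delta_le : delta <= 4^-1).
Hypothesis qN : q ^+ N <= 4^-1.
Hypothesis HE : H = 4 * Q + 1.
Hypothesis lower : forall x f, G x -> cls x f -> forall w, E (iter N theta x) w ->
  w 0%N = 0%N -> 2 * (delta * I x f) <= Pn N x f w.

Let rest x f : Seq -> R := fun t => Pn N x f t + (- (delta * I x f)) * ind_eq 0 t.

Lemma I_rest x f : G x -> cls x f ->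
  I (iter N theta x) (rest x f) = (1 - delta * I (iter N theta x) (ind_eq 0)) * I x f.
Proof.
move=> Gx fc; have GN := G_iter N Gx.
rewrite /rest I_lin//; [|exact/cls_adm/cls_Pn|exact: adm_ind_eq].
by rewrite cls_I_Pn//; ring.
Qed.

(** After [N] steps the cone constant is at most [Q + H / 4 <= H / 2], and [cone_sub] doubles it
    back to [H]. The supremum is at most [3/4 K I f], while the integral keeps at least three
    quarters of its value because [delta <= 1/4]. *)
Lemma cls_rest x f : G x -> cls x f -> cls (iter N theta x) (rest x f).
Proof.
move=> Gx fc; have GN := G_iter N Gx; have If0 := cls_I_ge0 Gx fc.
split.
  have -> : rest x f = fun t => Pn N x f t - delta * I x f * ind_eq 0 t.
    by apply/funext => t; rewrite /rest mulNr.
  apply: cone_sub => //; first by rewrite mulr_ge0 ?(ltW delta_gt0).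
  - apply: coneW (Pn_cone N Gx (cls_bdd fc) fc.1).
    have h1 : q ^+ N * H <= 4^-1 * H by rewrite ler_wpM2r.
    have h2 : Q * (1 - q ^+ N) <= Q.
      by rewrite ler_piMr ?Q_ge0// gerBl exprn_ge0 ?q_ge0.
    by move: h1 h2; rewrite HE; lra.
  - by move=> w Ew w0; exact: lower.
move=> w Ew; rewrite I_rest//.
have i1 : I (iter N theta x) (ind_eq 0) <= 1.
  rewrite -(I_cst 1 GN); apply: I_le => //; [exact: adm_ind_eq|exact: adm_cst|].
  by move=> t _; rewrite /ind_eq; case: ifP.
have i0 : 0 <= I (iter N theta x) (ind_eq 0).
  apply: I_ge0 => //; first exact: adm_ind_eq.
  by move=> t _; rewrite /ind_eq; case: ifP.
apply: (@le_trans _ _ (3 / 4 * (K * I x f))); last first.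
  rewrite [leRHS]mulrCA ler_wpM2r ?mulr_ge0//.
  have : delta * I (iter N theta x) (ind_eq 0) <= 4^-1 * 1.
    by rewrite ler_pM// ltW.
  lra.
apply: (@le_trans _ _ (Pn N x f w)).
  rewrite /rest gerDl mulNr oppr_le0 !mulr_ge0 ?(ltW delta_gt0)//.
  by rewrite /ind_eq; case: ifP.
by move: Ew; case: (N) N_gt0 => // n _ Ew; exact: cls_PnS_le.
Qed.

(** Strong induction in steps of [N]. Before time [N] both images lie between 0 and [K I f], and
    [th ^+ n / th ^+ N >= 1]. Otherwise pass to the remainders, whose common integral is smaller by
    a factor of at most [1 - delta c0 <= th ^+ N]. *)
Lemma cls_decay (th : R) : 0 < th -> th < 1 -> 1 - delta * c0 <= th ^+ N ->
  forall n x f1 f2, G x -> cls x f1 -> cls x f2 -> I x f1 = I x f2 ->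
  forall w, E (iter n theta x) w ->
  `|Pn n x f1 w - Pn n x f2 w| <= K / th ^+ N * th ^+ n * I x f1.
Proof.
move=> th0 th1 hth n; elim/ltn_ind: n => n IH x f1 f2 Gx fc1 fc2 If w Ew.
have If0 := cls_I_ge0 Gx fc1.
have [nN|Nn] := ltnP n N.
  have c1 := cls_Pn n Gx fc1; have c2 := cls_Pn n Gx fc2.
  have a1 := c1.1.1 _ Ew; have b1 := c1.2 _ Ew.
  have a2 := c2.1.1 _ Ew; have b2 := c2.2 _ Ew.
  rewrite !cls_I_Pn// in b1 b2.
  apply: (@le_trans _ _ (K * I x f1)).
    rewrite ler_norml -If in b2 *; lra.
  rewrite ler_wpM2r// -mulrA ler_peMr// mulrC ler_pdivlMr ?exprn_gt0// mul1r.
  by rewrite ler_wiXn2l ?(ltW th0) ?(ltW th1)// ltnW.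
have GN := G_iter N Gx.
have r1 := cls_rest Gx fc1; have r2 := cls_rest Gx fc2.
have Ir : I (iter N theta x) (rest x f1) = I (iter N theta x) (rest x f2).
  by rewrite !I_rest// If.
have Ew' : E (iter (n - N) theta (iter N theta x)) w by rewrite -iterD subnK.
have nN : (n - N < n)%N by rewrite ltn_subrL N_gt0 (leq_trans N_gt0 Nn).
have := IH _ nN _ _ _ GN r1 r2 Ir _ Ew'.
rewrite !Pn_lin//; [|exact/Pn_bdd/cls_bdd|exact: bdd_ind_eq
                   |exact/Pn_bdd/cls_bdd|exact: bdd_ind_eq].
(* The multiples of the indicator subtracted from the two functions coincide, since the integrals
   do, and cancel in the difference. *)
rewrite -If opprD addrACA subrr addr0 -!Pn_add subnKC// I_rest// => h.
apply: (le_trans h); rewrite mulrA ler_wpM2r//.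
rewrite -[leRHS](_ : K / th ^+ N * th ^+ (n - N) * th ^+ N = _); last first.
  by rewrite -mulrA -exprD subnK.
rewrite ler_wpM2l//.
  by rewrite !mulr_ge0 ?invr_ge0 ?exprn_ge0 ?(ltW th0).
apply: le_trans hth; rewrite lerB// ler_pM2l//; exact: l0_mass.
Qed.

End Decay.
End Class.

Lemma root_between (r : R) N : 0 < r -> r < 1 -> (0 < N)%N ->
  exists th : R, [/\ 0 < th, th < 1 & th ^+ N = r].
Proof.
move=> r0 r1 N0; exists (expR (ln r / N%:R)); rewrite expR_gt0; split=> //.
  by rewrite expR_lt1 pmulr_llt0 ?invr_gt0 ?ltr0n// ln_lt0// r0.
by rewrite -expRM_natr divfK ?lnK ?posrE// pnatr_eq0 -lt0n.
Qed.

Lemma transfer_decay : exists b th : R, [/\ 0 < b, 0 < th, th < 1 &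
  forall n x f (S : R), G x -> 0 <= S -> bounded_by (E x) f S ->
    (forall t w, E x t -> E x w -> t 0%N = w 0%N ->
      `|f t - f w| <= S * seq_dist t w `^ alpha) ->
    I x f = 0 ->
    forall w, E (iter n theta x) w ->
    `|Pn n x (fun t => f t + 2 * S) w - Pn n x (fun=> 2 * S) w| <= b * th ^+ n * S].
Proof.
(* The term [4 Q] lets the cone constant fall to [H / 2] after [N] steps; the term 1 admits the
   functions produced by [cone_shift]. *)
pose H := 4 * Q + 1; have Q0 := Q_ge0.
have QH : Q <= H by rewrite /H; lra.
have H0 : 0 <= H by exact: le_trans QH.
have half0 : (0 : R) < 2^-1 by rewrite invr_gt0.
have [l0 [l0P l0I]] := tail_small half0.
have [c1 c10 hc1] := mass_lower l0I.
(* The cap at 1 gives [exp H / c0 >= 1], hence [K >= 4], which puts both [f + 2 S] and [2 S] in the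
   class. *)
pose c0 := Num.min 1 c1.
have c00 : 0 < c0 by rewrite lt_min ltr01.
have hc0 x e : G x -> (e <= l0)%N -> c0 <= I x (ind_eq e).
  by move=> Gx el; rewrite (le_trans _ (hc1 x e Gx el))// ge_min lexx orbT.
pose K := 4 * D0 * (expR H / c0).
have K4 : 4 <= K.
  rewrite /K -mulrA ler_peMr// -[leLHS](mulr1 1) ler_pM//.
  rewrite ler_pdivlMr// mul1r (@le_trans _ _ 1)//; first by rewrite ge_min lexx.
  by rewrite -expR0 ler_expR.
have [N [delta delta0 [N0 delta4 qN low]]] := cls_lower QH c00 (erefl K).
have r0 : 0 < 1 - delta * c0.
  rewrite subr_gt0 (@le_lt_trans _ _ (4^-1 * 1))//; last by rewrite mulr1 invf_lt1 ?ltr1n.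
  by rewrite ler_pM ?(ltW delta0) ?(ltW c00)// ge_min lexx.
have r1 : 1 - delta * c0 < 1 by rewrite gtrBl mulr_gt0.
have [th [th0 th1 thN]] := root_between r0 r1 N0.
exists (2 * (K / th ^+ N)), th; split=> //.
  by rewrite mulr_gt0// divr_gt0 ?exprn_gt0// (lt_le_trans _ K4).
move=> n x f S Gx S0 fS hf If w Ew.
have f1 := cone_shift S0 fS hf.
have S2 : 0 <= 2 * S by rewrite mulr_ge0.
have fb : bdd x f by exists S.
have f2b : bdd x (fun t => f t + 2 * S).
  have := bdd_lin (2 * S) fb (bdd_cst x 1).
  by congr (bdd x _); apply/funext => t; rewrite mulr1.
have a1 : adm x (fun t => f t + 2 * S) by exact: adm_cone f1 f2b.
have fa : adm x f.
  have := adm_lin (-1) a1 (adm_cst x (2 * S)).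
  by congr (adm x _); apply/funext => t; rewrite mulN1r addrK.
have I1 : I x (fun t => f t + 2 * S) = 2 * S.
  by have := I_lin (2 * S) Gx fa (adm_cst x 1); rewrite I_cst// If add0r mulr1.
have hK : 4 * S <= K * S by rewrite ler_wpM2r.
have c2 : cls H K x (fun t => f t + 2 * S).
  split; first by apply: coneW f1; rewrite /H; lra.
  move=> u Eu; rewrite I1; have := fS u Eu; rewrite ler_norml => /andP[_ h].
  by apply: (@le_trans _ _ (2 * (K * S))); lra.
have c3 : cls H K x (fun=> 2 * S).
  split; first exact: cone_cst.
  by move=> u Eu; rewrite I_cst//; lra.
have := cls_decay QH c00 l0P hc0 (erefl K) N0 delta0 delta4 qN (erefl H) low th0 th1 _ Gx c2 c3 _ Ew.
rewrite thN lexx I1 I_cst// => /(_ isT erefl) /le_trans; apply.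
by rewrite mulrCA !mulrA.
Qed.

End Iteration.

(** * Measures with a density *)

Section MeasureDensity.
Local Open Scope ereal_scope.
Context d (T : measurableType d) (R : realType) (mu : {measure set T -> \bar R}).
Variable f : T -> R.
Hypotheses (mf : measurable_fun setT f) (f0 : forall t, (0 <= f t)%R).

(** The two proofs are arguments so that the term itself determines a measure structure. *)
Definition mdens of measurable_fun setT f & (forall t, (0 <= f t)%R) :=
  fun B : set T => \int[mu]_(t in B) (f t)%:E.

Local Notation nu := (mdens mf f0).

Let mEf : measurable_fun setT (EFin \o f).
Proof. exact/measurable_EFinP. Qed.

Let Ef0 t : 0 <= (f t)%:E.
Proof. by rewrite lee_fin f0. Qed.

Let mdens0 : nu set0 = 0.
Proof. by rewrite /mdens integral_set0. Qed.

Let mdens_ge0 B : 0 <= nu B.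
Proof. by apply: integral_ge0 => t _; rewrite lee_fin f0. Qed.

Let mdens_sigma_additive : semi_sigma_additive nu.
Proof.
by apply: semi_sigma_additive_nng_induced => [|t]; [exact/measurable_EFinP|rewrite lee_fin f0].
Qed.

HB.instance Definition _ :=
  isMeasure.Build _ _ _ nu mdens0 mdens_ge0 mdens_sigma_additive.

Import HBNNSimple.

Lemma integral_mdens_nnsfun (h : {nnsfun T >-> R}) :
  \int[nu]_t (h t)%:E = \int[mu]_t ((h t)%:E * (f t)%:E).
Proof.
rewrite integralT_nnsfun sintegralE.
transitivity (\int[mu]_t \sum_(y \in range h)
    ((y * \1_(h @^-1` [set y]) t)%:E * (f t)%:E)); last first.
  apply: eq_integral => t _.
  by rewrite -ge0_mule_fsuml => [|y]; [rewrite fsumEFin// -fimfunE|exact: nnfun_muleindic_ge0].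
rewrite ge0_integral_fsum//; last 2 first.
- by move=> y; apply: emeasurable_funM => //; apply/measurable_EFinP; exact: measurable_funM.
- by move=> y t _; rewrite mule_ge0// nnfun_muleindic_ge0.
apply: eq_fsbigr => y; rewrite inE => -[t0 _ <-].
under eq_integral do rewrite EFinM -muleA.
rewrite ge0_integralZl//; last 3 first.
- by apply: emeasurable_funM => //; exact/measurable_EFinP.
- by move=> t _; rewrite mule_ge0// lee_fin.
- by rewrite lee_fin.
congr (_ * _); transitivity (\int[mu]_(t in h @^-1` [set h t0]) (f t)%:E) => //.
rewrite integral_mkcond.
by apply: eq_integral => t _; rewrite epatch_indic muleC.
Qed.

(** Simple functions first, then monotone convergence on both sides. *)
Lemma ge0_integral_mdens (g : T -> \bar R) : measurable_fun setT g ->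
  (forall t, 0 <= g t) -> \int[nu]_t g t = \int[mu]_t (g t * (f t)%:E).
Proof.
move=> mg g0; pose h := nnsfun_approx measurableT mg.
have gE t : lim ((EFin \o h n) t @[n --> \oo]) = g t.
  by apply/cvg_lim => //; exact: cvg_nnsfun_approx.
transitivity (lim (\int[nu]_t (h n t)%:E @[n --> \oo])).
  rewrite -monotone_convergence//.
  - by apply: eq_integral => t _; rewrite -gE.
  - by move=> n; apply/measurable_EFinP; exact/measurable_funP.
  - by move=> n t _; rewrite lee_fin.
  - by move=> t _ a b ab; rewrite lee_fin; exact/lefP/nd_nnsfun_approx.
under eq_fun do rewrite integral_mdens_nnsfun.
rewrite -monotone_convergence//.
- apply: eq_integral => t _.
  have ht : (h n t)%:E @[n --> \oo] --> g t by exact: cvg_nnsfun_approx.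
  by apply/cvg_lim => //; exact: cvgeZr.
- by move=> n; apply: emeasurable_funM => //; apply/measurable_EFinP; exact/measurable_funP.
- by move=> n t _; rewrite mule_ge0// lee_fin.
- by move=> t _ a b ab; rewrite lee_wpmul2r// lee_fin; exact/lefP/nd_nnsfun_approx.
Qed.

End MeasureDensity.

(** * Open, clopen and measurable sets of sequences *)

Section SeqMeasurable.
Implicit Types (B : set Seq) (w t : Seq).

Definition seq_open B : Prop :=
  forall w, B w -> exists n, forall t, agree n w t -> B t.

(** Clopen sets have continuous indicators, so conformality applies to them, and they form an
    intersection-stable family generating the sigma-algebra. *)
Definition seq_clopen B : Prop := seq_open B /\ seq_open (~` B).

Lemma seq_clopenI : setI_closed seq_clopen.
Proof.
move=> B C [oB cB] [oC cC]; split.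
  move=> w [/oB [n hn] /oC [k hk]]; exists (maxn n k) => t wt; split.
    by apply/hn/(agreeW (leq_maxl n k)).
  by apply/hk/(agreeW (leq_maxr n k)).
rewrite setCI => w [/cB [n hn]|/cC [n hn]]; exists n => t wt; [left|right];
  exact: hn.
Qed.

Lemma seq_clopenT : seq_clopen setT.
Proof. by split=> [w _|w []//]; exists 0%N. Qed.

Lemma seq_clopen_cylinder i k : seq_clopen [set w | w i = k].
Proof.
by split=> w /= wi; exists i.+1 => t wt /=; rewrite -wt.
Qed.

Lemma measurable_coord i k : measurable ([set w | w i = k] : set Seq).
Proof. by apply: sub_sigma_algebra; exists i, k. Qed.

(** An open set is the union of the cylinders of finite words contained in it, and finite words are
    countably many. *)
Lemma seq_open_measurable B : seq_open B -> measurable B.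
Proof.
move=> oB; pose pre (s : seq nat) : set Seq :=
  \bigcap_i [set w | (i < size s)%N -> w i = nth 0%N s i].
pose F s : set Seq := if pselect (pre s `<=` B) then pre s else set0.
have -> : B = \bigcup_s F s.
  apply/seteqP; split=> [w Bw|w [s _]]; last first.
    by rewrite /F; case: pselect => // sB /sB.
  have [n hn] := oB w Bw; exists (mkseq w n) => //.
  have wpre : pre (mkseq w n) w.
    by move=> i _ /=; rewrite size_mkseq => ilt; rewrite nth_mkseq.
  rewrite /F; case: pselect => // -[] t ht; apply: hn => i ilt.
  by have := ht i Logic.I; rewrite /= size_mkseq nth_mkseq// => ->.
apply: countable_bigcupT_measurable => // s.
rewrite /F; case: pselect => [h|h] //=; apply: bigcapT_measurable => i.
have [ilt|ige] := ltnP i (size s).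
  rewrite (_ : [set w | _] = [set w | w i = nth 0%N s i]); first exact: measurable_coord.
  by apply/seteqP; split=> w /=; [exact|move=> -> ].
by rewrite (_ : [set w | _] = setT)//; apply/seteqP; split.
Qed.

Lemma seq_measurableE : @measurable _ Seq = <<s seq_clopen >>.
Proof.
apply/seteqP; split.
  apply: smallest_sub; first exact: smallest_sigma_algebra.
  move=> B [i [k ->]]; apply: sub_sigma_algebra; exact: seq_clopen_cylinder.
apply: smallest_sub; first exact: sigma_algebra_measurable.
by move=> B [oB _]; exact: seq_open_measurable.
Qed.

Lemma measurable_shiftn n : measurable_fun setT (shiftn n : Seq -> Seq).
Proof.
apply: (@measurability _ _ Seq Seq setT (shiftn n) cylinders) => // B [C [i [k ->]] <-].
rewrite setTI; exact: (measurable_coord (i + n) k).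
Qed.

Lemma measurable_Efib {d} {X : measurableType d} (theta : X -> X)
  (A : X -> nat -> nat -> bool) x : measurable (Efib theta A x).
Proof.
rewrite -[Efib _ _ _]setCK; apply: measurableC; apply: seq_open_measurable.
move=> w /existsNP [i hi]; exists i.+2 => t wt Et; apply: hi.
by rewrite !wt//; exact: Et.
Qed.

Lemma cont_on_measurable {R : realType} (D : set Seq) (f : Seq -> R) :
  cont_on D f -> measurable_fun D f.
Proof.
move=> fc mD; apply: (measurability _ (RGenOInfty.measurableE R)) => //.
move=> _ [_ [x ->] <-].
(* The union of the cylinders on whose trace in [D] the function exceeds [x]: an open set cutting
   out the superlevel set. *)
pose U : set Seq := [set t | exists n w, [/\ agree n w t &
  forall u, D u -> agree n w u -> x < f u]].
rewrite (_ : _ `&` _ = D `&` U).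
  apply: measurableI => //; apply: seq_open_measurable => t [n [w [wt hw]]].
  by exists n => u tu; exists n, w; split=> //; exact: agree_trans tu.
apply/seteqP; split=> [w [Dw]|w [Dw [n [u [uw h]]]]].
  rewrite /= in_itv/= andbT => xw; split=> //.
  have [|n hn] := (cont_onP _ _).1 fc w Dw (f w - x); first by rewrite subr_gt0.
  exists n, w; split=> // u Du wu; have := hn u Du wu.
  by rewrite ltr_norml => /andP[+ _]; rewrite opprB ltrD2r.
by split=> //=; rewrite in_itv/= andbT; exact: h.
Qed.

End SeqMeasurable.

(** * Equality of two weighted measures *)

Section WeightedTransfer.
Context {R : realType}.
Variables (mu1 mu2 : {measure set Seq -> \bar R}) (D1 D2 : set Seq).
Variables (s : Seq -> Seq) (f1 f2 : Seq -> R).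
Hypotheses (mD1 : measurable D1) (mD2 : measurable D2).
Hypothesis ms : measurable_fun setT s.
Hypothesis sD : forall w, D1 w -> D2 (s w).
Hypotheses (mf1 : measurable_fun D1 f1) (mf2 : measurable_fun D2 f2).
Hypotheses (f10 : forall w, D1 w -> 0 <= f1 w) (f20 : forall w, D2 w -> 0 <= f2 w).
Local Open Scope ereal_scope.
Hypothesis fin1 : \int[mu1]_(w in D1) (f1 w)%:E < +oo.
Hypothesis clopen_eq : forall B, seq_clopen B ->
  \int[mu1]_(w in D1) (\1_B (s w) * f1 w)%:E = \int[mu2]_(w in D2) (\1_B w * f2 w)%:E.

Let F1 := f1 \_ D1.
Let F2 := f2 \_ D2.

Let mF1 : measurable_fun setT F1.
Proof. exact/(measurable_restrictT _ _).1. Qed.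

Let mF2 : measurable_fun setT F2.
Proof. exact/(measurable_restrictT _ _).1. Qed.

Let F10 w : (0 <= F1 w)%R.
Proof. by rewrite /F1 patchE; case: ifPn => // /set_mem; exact: f10. Qed.

Let F20 w : (0 <= F2 w)%R.
Proof. by rewrite /F2 patchE; case: ifPn => // /set_mem; exact: f20. Qed.

Let m1 := pushforward (mdens mu1 mF1 F10) s.
Let m2 := mdens mu2 mF2 F20.

Let patch_int (mu : {measure set Seq -> \bar R}) (D : set Seq) (f : Seq -> R) (g : Seq -> \bar R) :
  \int[mu]_w (g w * ((f \_ D) w)%:E) = \int[mu]_(w in D) (g w * (f w)%:E).
Proof.
rewrite [RHS]integral_mkcond; apply: eq_integral => w _.
by rewrite !patchE; case: ifPn => // _; rewrite mule0.
Qed.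

Let mdens_clopen (mu : {measure set Seq -> \bar R}) (D : set Seq) (f : Seq -> R) (B : set Seq) :
  \int[mu]_(w in B) ((f \_ D) w)%:E = \int[mu]_(w in D) (\1_B w * f w)%:E.
Proof.
rewrite integral_mkcond [RHS]integral_mkcond; apply: eq_integral => w _.
rewrite !patchE indicE; case: ifPn => wB; case: ifPn => wD //.
- by rewrite mul1r.
- by rewrite mul0r.
Qed.

(** The image under [s] of the measure with density [f1] and the measure with density [f2] agree on
    clopen sets and have finite mass, so uniqueness of measures applies. *)
Let m12 B : measurable B -> m1 B = m2 B.
Proof.
apply: (measure_unique seq_clopen (fun=> setT)) => //.
- exact: seq_measurableE.
- exact: seq_clopenI.
- by move=> _; exact: seq_clopenT.
- by rewrite bigcup_const.
- move=> C cC; transitivity (\int[mu1]_(w in D1) (\1_C (s w) * f1 w)%:E).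
    exact: (mdens_clopen mu1 D1 f1 (s @^-1` C)).
  by rewrite clopen_eq//; exact/esym/mdens_clopen.
- move=> _; apply: le_lt_trans fin1; rewrite le_eqVlt; apply/orP; left; apply/eqP.
  transitivity (\int[mu1]_(w in D1) (\1_[set: Seq] (s w) * f1 w)%:E).
    exact: (mdens_clopen mu1 D1 f1 (s @^-1` setT)).
  by apply: eq_integral => w _; rewrite indicT mul1r.
Qed.

Lemma ge0_weighted_transfer (g : Seq -> \bar R) : measurable_fun D2 g ->
  (forall w, D2 w -> 0 <= g w) ->
  \int[mu1]_(w in D1) (g (s w) * (f1 w)%:E) = \int[mu2]_(w in D2) (g w * (f2 w)%:E).
Proof.
move=> mg g0.
have mg' : measurable_fun setT (g \_ D2) by exact/(measurable_restrictT _ _).1.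
have g'0 w : 0 <= (g \_ D2) w.
  by rewrite patchE; case: ifPn => // /set_mem; exact: g0.
transitivity (\int[mu2]_w ((g \_ D2) w * (F2 w)%:E)); last first.
  rewrite patch_int; apply: eq_integral => w wD.
  by rewrite patchE wD.
rewrite -ge0_integral_mdens//.
rewrite -(@eq_measure_integral _ _ _ setT m2 m1); last by move=> B mB _; exact: m12.
symmetry; transitivity (\int[mdens mu1 mF1 F10]_w (g \_ D2) (s w)).
  exact: (ge0_integral_pushforward ms (mdens mu1 mF1 F10) measurableT mg').
rewrite ge0_integral_mdens//; last exact: measurableT_comp.
rewrite patch_int; apply: eq_integral => w wD1.
by rewrite /= patchE mem_set//; apply: sD; exact: set_mem.
Qed.

End WeightedTransfer.

Lemma pos_part_mul {R : realType} (a b : R) : 0 <= b ->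
  maxe (a * b)%:E 0%E = ((Num.max a 0)%:E * b%:E)%E.
Proof. by move=> b0; rewrite -EFinM -EFin_max maxr_pMl// mul0r. Qed.

(** * Integrals over the fibres and duality *)

Section FibreIntegral.
Context {R : realType} {d : measure_display} {X : measurableType d}.
Variables (theta : X -> X) (A : X -> nat -> nat -> bool) (phi : X -> Seq -> R).
Variables (lam : X -> R) (G : set X) (k1 k2 D0 alpha V : R).
Variable nu : X -> {measure set Seq -> \bar R}.
Local Notation E := (Efib theta A).
Local Notation Pop := (Pop A phi lam).
Local Notation Pn := (Pn theta A phi lam).
Local Notation adm := (@adm R _ _ theta A).
Local Notation bdd := (@bdd R _ _ theta A).
Local Notation cone := (cone alpha).
Hypothesis Gtheta : forall x, G x -> G (theta x).
Hypotheses (k1_gt0 : 0 < k1) (k2_gt0 : 0 < k2) (D0_ge1 : 1 <= D0).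
Hypothesis lam_bounds : forall x, G x -> k1 <= (lam x)^-1 /\ (lam x)^-1 <= k2.
Hypothesis Lpos1 : forall x, G x -> forall w, E (theta x) w ->
  (Lpos A phi x (cst 1%R) w <= (D0 / k2)%:E)%E.
Hypotheses (alpha0 : 0 < alpha) (V_ge0 : 0 <= V).
Hypothesis phi_holder : forall x, G x -> forall t w, E x t -> E x w ->
  t 0%N = w 0%N -> `|phi x t - phi x w| <= V * seq_dist t w `^ alpha.
Hypothesis nuE : forall x, G x -> nu x (E x) = 1%E.
Hypothesis nu_conformal : forall x, G x -> forall g : Seq -> R,
  cont_on (E x) g -> (sup_norm (E x) g < +oo)%E ->
  (\int[nu (theta x)]_(w in E (theta x)) (Lop A phi x g w)%:E
   = (lam x)%:E * \int[nu x]_(w in E x) (g w)%:E)%E.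

Definition fibre_int (x : X) (f : Seq -> R) : R := Rintegral (nu x) (E x) f.
Local Notation I := fibre_int.

Lemma adm_measurable x f : adm x f -> measurable_fun (E x) f.
Proof. by move=> [fc _]; exact: cont_on_measurable. Qed.

Lemma bounded_integrable x f : G x -> measurable_fun (E x) f -> bdd x f ->
  (nu x).-integrable (E x) (EFin \o f).
Proof.
move=> Gx mf [M M0 fM]; apply: measurable_bounded_integrable => //.
- exact: measurable_Efib.
- by rewrite nuE// ltry.
- exists M; split; first by rewrite num_real.
  by move=> y My w Ew; apply: le_trans (fM w Ew) (ltW My).
Qed.

Lemma adm_integrable x f : G x -> adm x f -> (nu x).-integrable (E x) (EFin \o f).
Proof.
move=> Gx fa; apply: bounded_integrable => //; first exact: adm_measurable.
exact: fa.2.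
Qed.

Lemma EFin_fibre_int x f : G x -> adm x f ->
  (I x f)%:E = (\int[nu x]_(w in E x) (f w)%:E)%E.
Proof.
move=> Gx fa; rewrite /fibre_int /Rintegral fineK//.
by apply: integrable_fin_num; [exact: measurable_Efib|exact: adm_integrable].
Qed.

Lemma fibre_int_lin x f g (k : R) : G x -> adm x f -> adm x g ->
  I x (fun t => f t + k * g t) = I x f + k * I x g.
Proof.
move=> Gx fa ga; have mE := measurable_Efib theta A x.
have fi := adm_integrable Gx fa; have gi := adm_integrable Gx ga.
have kgi : (nu x).-integrable (E x) (EFin \o (fun w => k * g w)).
  have := integrableZl mE k gi.
  by apply: eq_integrable => // w _; rewrite /= EFinM.
have e1 := RintegralD mE fi kgi; have e2 := RintegralZl k mE gi.
by rewrite /fibre_int /= -e2 -e1.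
Qed.

Lemma fibre_int_le x f g : G x -> adm x f -> adm x g ->
  (forall t, E x t -> f t <= g t) -> I x f <= I x g.
Proof.
move=> Gx fa ga fg; apply: le_Rintegral.
- exact: measurable_Efib.
- exact: adm_integrable.
- exact: adm_integrable.
- exact: fg.
Qed.

Lemma fibre_int1 x : G x -> I x (cst 1%R) = 1.
Proof.
move=> Gx; rewrite /fibre_int Rintegral_cst ?nuE ?mulr1//.
exact: measurable_Efib.
Qed.

Lemma lam_neq0 x : G x -> lam x != 0.
Proof.
by move=> /lam_bounds[h _]; rewrite -invr_eq0 gt_eqF//; exact: lt_le_trans h.
Qed.

Lemma fibre_int_Pop x f : G x -> adm x f -> adm (theta x) (Pop x f) ->
  I (theta x) (Pop x f) = I x f.
Proof.
move=> Gx fa Pfa; have GTx := Gtheta Gx; have mE := measurable_Efib theta A (theta x).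
have l0 := lam_neq0 Gx.
have eL : Lop A phi x f = fun w => lam x * Pop x f w.
  by apply/funext => w; rewrite /Pop mulVKf.
have sf : (sup_norm (E x) f < +oo)%E.
  by have [_ [M M0 fM]] := fa; exact: sup_norm_lty M0 fM.
have := nu_conformal Gx fa.1 sf.
rewrite -(EFin_fibre_int Gx fa) eL.
under eq_integral do rewrite EFinM.
rewrite integralZl//; last exact: adm_integrable.
by rewrite -(EFin_fibre_int GTx Pfa) -!EFinM => -[] /(mulfI l0).
Qed.

Lemma seq_clopen_shiftn n (B : set Seq) : seq_clopen B -> seq_clopen (shiftn n @^-1` B).
Proof.
by move=> [oB cB]; split=> w /=; [move=> /oB|move=> /cB] => -[k hk]; exists (k + n)%N => t wt;
  apply: hk; exact: agree_shiftn.
Qed.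

Lemma adm_indicM x (B : set Seq) f : seq_clopen B -> adm x f ->
  adm x (fun w => \1_B w * f w).
Proof.
move=> [oB cB] [fc [M M0 fM]]; split; last first.
  exists M => // w Ew; rewrite normrM indicE.
  by case: (w \in B); rewrite ?normr1 ?mul1r ?normr0 ?mul0r ?fM.
apply/cont_onP => w Ew eps eps0.
have [n1 h1] := (cont_onP _ _).1 fc w Ew eps eps0.
have [n2 h2] : exists n, forall t, agree n w t -> (\1_B t : R) = \1_B w.
  have [wB|wB] := pselect (B w).
    have [n hn] := oB w wB; exists n => t /hn tB.
    by rewrite !indicE !mem_set.
  have [n hn] := cB w wB; exists n => t /hn tB.
  by rewrite !indicE !memNset.
exists (maxn n1 n2) => t Et wt.
rewrite (h2 t (agreeW (leq_maxr _ _) wt)) -mulrBr normrM.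
apply: le_lt_trans (h1 t Et (agreeW (leq_maxl _ _) wt)).
by rewrite ler_piMl// indicE; case: (w \in B); rewrite ?normr1 ?normr0.
Qed.

(** All preimages of [w] have the same shift [w], so the factor [g o sigma] is constant along the
    series and comes out. *)
Lemma Pop_shift1M x f (g : Seq -> R) w : G x -> bdd x f -> E (theta x) w ->
  Pop x (fun t => g (shiftn 1 t) * f t) w = g w * Pop x f w.
Proof.
move=> Gx [M _ fM] Ew.
have eL : Lop A phi x (fun t => g (shiftn 1 t) * f t) w = g w * Lop A phi x f w.
  rewrite -(LopZ Ew (Lpos1 Gx Ew) _ fM) /Lop.
  congr (limn (series _)); apply/funext => e; rewrite /Lterm; case: ifP => // _.
  by rewrite shiftn_scons shiftn0.
transitivity ((lam x)^-1 * (g w * Lop A phi x f w)); first by rewrite -eL.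
by rewrite mulrCA.
Qed.

Lemma eq_fibre_int x f g : (forall t, E x t -> f t = g t) -> I x f = I x g.
Proof. by move=> fg; apply: eq_Rintegral => t /set_mem; exact: fg. Qed.

(** Induction on [n]: one application of [P] preserves the integral and, by [Pop_shift1M], removes
    one shift from the indicator while replacing [f] by [P f]. *)
Lemma fibre_int_clopen n H x f (B : set Seq) : 0 <= H -> G x -> bdd x f ->
  cone H (E x) f -> seq_clopen B ->
  I x (fun w => \1_B (shiftn n w) * f w) =
  I (iter n theta x) (fun w => \1_B w * Pn n x f w).
Proof.
elim: n H x f => [|n IH] H x f H0 Gx fb fH cB.
  by apply: eq_fibre_int => w _; rewrite shiftn0.
have PH := Pop_cone k1_gt0 lam_bounds Lpos1 phi_holder Gx fb fH.
have Pb := Pop_bdd k1_gt0 k2_gt0 D0_ge1 lam_bounds Lpos1 Gx fb.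
have H'0 : 0 <= expR (- alpha) * (H + V) by rewrite mulr_ge0 ?expR_ge0 ?addr_ge0.
have GTx := Gtheta Gx.
rewrite iterSr /= -(IH _ _ _ H'0 GTx Pb PH cB).
have fa := adm_cone alpha0 H0 fH fb.
have Pa := adm_cone alpha0 H'0 PH Pb.
have eP w : E (theta x) w -> Pop x (fun w => \1_B (shiftn n.+1 w) * f w) w =
    \1_B (shiftn n w) * Pop x f w.
  move=> Ew; rewrite -(Pop_shift1M (fun w => \1_B (shiftn n w)))//.
  by congr (Pop x _ w); apply/funext => t; rewrite shiftnS.
rewrite -(eq_fibre_int eP) fibre_int_Pop//.
  exact: (adm_indicM (seq_clopen_shiftn n.+1 cB) fa).
(* A function multiplied by an indicator need not stay in the cone, so its image is shown admissible
   through the formula [eP]. *)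
have [c [M M0 bM]] := adm_indicM (seq_clopen_shiftn n cB) Pa; split.
  by move=> w Ew eps /(c w Ew) [de de0 hde]; exists de => // t Et wt; rewrite !eP//; exact: hde.
by exists M => // w Ew; rewrite eP//; exact: bM.
Qed.

Section Duality.
Variables (n : nat) (H : R) (x : X) (f : Seq -> R).
Hypotheses (H0 : 0 <= H) (Gx : G x) (fb : bdd x f) (fH : cone H (E x) f).
Local Notation y := (iter n theta x).

Let Gy : G y. Proof. exact: G_iter. Qed.

Let Pf0 w : E y w -> 0 <= Pn n x f w.
Proof. by move=> Ew; apply: (Pn_ge0 Gtheta k1_gt0 k2_gt0 D0_ge1 lam_bounds Lpos1) => //; exact: fH.1. Qed.

Let Pfb : bdd y (Pn n x f).
Proof. exact: (Pn_bdd Gtheta k1_gt0 k2_gt0 D0_ge1 lam_bounds Lpos1). Qed.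

Let Pfa : adm y (Pn n x f).
Proof.
have PH := Pn_cone Gtheta k1_gt0 k2_gt0 D0_ge1 lam_bounds Lpos1 alpha0 phi_holder n Gx fb fH.
apply: (adm_cone alpha0 _ PH Pfb).
have qn : expR (- alpha) ^+ n <= 1.
  by rewrite exprn_ile1 ?expR_ge0// expR_le1 oppr_le0 ltW.
rewrite addr_ge0 ?mulr_ge0 ?exprn_ge0 ?expR_ge0 ?subr_ge0 ?invr_ge0//.
by rewrite subr_ge0 expR_le1 oppr_le0 ltW.
Qed.

Let fa : adm x f. Proof. exact: adm_cone fH fb. Qed.

Lemma ge0_duality (g : Seq -> \bar R) : measurable_fun (E y) g ->
  (forall w, E y w -> 0 <= g w)%E ->
  (\int[nu x]_(w in E x) (g (shiftn n w) * (f w)%:E) =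
   \int[nu y]_(w in E y) (g w * (Pn n x f w)%:E))%E.
Proof.
move=> mg g0; apply: ge0_weighted_transfer => //.
- exact: measurable_Efib.
- exact: measurable_Efib.
- exact: measurable_shiftn.
- by move=> w; exact: Efib_shiftn.
- exact: adm_measurable.
- exact: adm_measurable.
- exact: fH.1.
- by rewrite -EFin_fibre_int// ltry.
- move=> B cB; rewrite -!EFin_fibre_int//.
  + by rewrite (fibre_int_clopen _ H0).
  + exact: adm_indicM.
  + exact: (adm_indicM (seq_clopen_shiftn n cB)).
Qed.

(** On the right [P^n f] is bounded, hence the product is integrable; nonnegative duality for [|g|]
    transports this to the left. As [f] and [P^n f] are nonnegative, positive and negative parts of
    the products come from those of [g] and are treated separately. *)
Lemma duality (g : Seq -> R) : (nu y).-integrable (E y) (EFin \o g) ->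
  (nu x).-integrable (E x) (fun w => (g (shiftn n w) * f w)%:E) /\
  (nu y).-integrable (E y) (fun w => (g w * Pn n x f w)%:E) /\
  (\int[nu x]_(w in E x) (g (shiftn n w) * f w)%:E =
   \int[nu y]_(w in E y) (g w * Pn n x f w)%:E)%E.
Proof.
move=> gi; have mg : measurable_fun (E y) g.
  by apply/measurable_EFinP; exact: measurable_int gi.
have mEx := measurable_Efib theta A x; have mEy := measurable_Efib theta A y.
have mgs : measurable_fun (E x) (fun w => g (shiftn n w)).
  apply: (measurable_comp mEy) => //.
    by move=> _ [w Ew <-]; exact: Efib_shiftn.
  exact: measurable_funTS (measurable_shiftn n).
have mf := adm_measurable fa.
have mPf := adm_measurable Pfa.
have i2 : (nu y).-integrable (E y) (fun w => (g w * Pn n x f w)%:E).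
  have [M M0 PM] := Pfb.
  have bP : [bounded Pn n x f w | w in E y].
    exists M; split; first by rewrite num_real.
    by move=> z Mz w Ew; apply: le_trans (PM w Ew) (ltW Mz).
  have := integrableMl mEy gi mPf bP.
  by apply: eq_integrable => // w _; rewrite /= EFinM.
have mag : measurable_fun (E y) (fun w => `|g w|%:E).
  by apply/measurable_EFinP; exact: measurableT_comp.
have i1 : (nu x).-integrable (E x) (fun w => (g (shiftn n w) * f w)%:E).
  apply/integrableP; split.
    by apply/measurable_EFinP; exact: measurable_funM.
  have /integrableP[_] := i2; apply: le_lt_trans.
  rewrite le_eqVlt; apply/orP; left; apply/eqP.
  transitivity (\int[nu x]_(w in E x) (`|g (shiftn n w)|%:E * (f w)%:E))%E.
    apply: eq_integral => w /set_mem Ew.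
    by rewrite /= normrM (ger0_norm (fH.1 _ Ew)) EFinM.
  rewrite (ge0_duality mag)//.
  apply: eq_integral => w /set_mem Ew.
  by rewrite /= normrM (ger0_norm (Pf0 Ew)) EFinM.
split=> //; split=> //.
have key (u : Seq -> R) : measurable_fun (E y) u ->
    (\int[nu x]_(w in E x) maxe (u (shiftn n w) * f w)%:E 0 =
     \int[nu y]_(w in E y) maxe (u w * Pn n x f w)%:E 0)%E.
  move=> mu; have := @ge0_duality (fun w => (Num.max (u w) 0)%:E).
  have mmax : measurable_fun (E y) (fun w => (Num.max (u w) 0)%:E).
    by apply/measurable_EFinP; exact: measurable_maxr.
  move=> /(_ mmax) h; transitivity
    (\int[nu x]_(w in E x) ((Num.max (u (shiftn n w)) 0)%:E * (f w)%:E))%E.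
    by apply: eq_integral => w /set_mem Ew; rewrite pos_part_mul// fH.1.
  rewrite h; last by move=> w _; rewrite lee_fin le_max lexx orbT.
  by apply: eq_integral => w /set_mem Ew; rewrite pos_part_mul// Pf0.
rewrite integralE [RHS]integralE; congr (_ - _)%E.
  under eq_integral do rewrite funeposE.
  by under [RHS]eq_integral do rewrite funeposE; exact: (key g mg).
have mNg : measurable_fun (E y) (fun w => - g w) by exact: measurableT_comp.
have kN := key _ mNg.
have eN (a b : R) : maxe (- (a * b)%:E)%E 0%E = maxe (- a * b)%:E 0%E.
  by rewrite mulNr EFinN.
transitivity (\int[nu x]_(w in E x) maxe (- g (shiftn n w) * f w)%:E 0)%E.
  by apply: eq_integral => w _; rewrite funenegE; exact: eN.
by rewrite kN; apply: eq_integral => w _; rewrite funenegE; exact/esym/eN.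
Qed.

End Duality.

(** Duality needs nonnegative weights, so a signed weight enters as [f1 - f2]. After transport only
    [P^n f1 - P^n f2] multiplies [g], and its supremum bound comes out of the integral. *)
Lemma fibre_integral_le n H x f1 f2 (M : R) (g : Seq -> R) : 0 <= H -> G x ->
  bdd x f1 -> cone H (E x) f1 -> bdd x f2 -> cone H (E x) f2 -> 0 <= M ->
  (nu (iter n theta x)).-integrable (E (iter n theta x)) (EFin \o g) ->
  (forall w, E (iter n theta x) w -> `|Pn n x f1 w - Pn n x f2 w| <= M) ->
  (`| \int[nu x]_(w in E x) (g (shiftn n w) * (f1 w - f2 w))%:E | <=
   M%:E * \int[nu (iter n theta x)]_(w in E (iter n theta x)) `|g w|%:E)%E.
Proof.
move=> H0 Gx b1 c1 b2 c2 M0 gi hM; set y := iter n theta x.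
have mEx := measurable_Efib theta A x; have mEy := measurable_Efib theta A y.
have [i1 [j1 e1]] := duality H0 Gx b1 c1 gi.
have [i2 [j2 e2]] := duality H0 Gx b2 c2 gi.
have -> : (\int[nu x]_(w in E x) (g (shiftn n w) * (f1 w - f2 w))%:E =
    \int[nu y]_(w in E y) (g w * Pn n x f1 w - g w * Pn n x f2 w)%:E)%E.
  under eq_integral do rewrite mulrBr.
  by rewrite integralB_EFin// [RHS]integralB_EFin// e1 e2.
have jB : (nu y).-integrable (E y) (fun w => (g w * Pn n x f1 w - g w * Pn n x f2 w)%:E).
  by have := integrableB mEy j1 j2; apply: eq_integrable.
apply: le_trans (le_abse_integral _ mEy (measurable_int _ jB)) _.
have mg : measurable_fun (E y) g.
  by apply/measurable_EFinP; exact: measurable_int gi.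
have mag : measurable_fun (E y) (fun w => `|g w|%:E).
  by apply/measurable_EFinP; exact: measurableT_comp.
rewrite -ge0_integralZl//.
apply: ge0_le_integral => //.
- by apply: measurableT_comp => //; exact: measurable_int jB.
- by apply: emeasurable_funM => //.
move=> w Ew; rewrite /= -EFinM lee_fin -mulrBr normrM mulrC.
by rewrite ler_wpM2r// hM.
Qed.

Variable c : nat -> R.
Hypothesis c_gt0 : forall e, 0 < c e.
Hypothesis phi_lower : forall x, G x -> forall w, E x w -> c (w 0%N) <= expR (phi x w).
Hypothesis followers : forall e, exists r, forall x, G x -> forall e',
  A x e e' -> (e' <= r)%N.
Hypothesis mixing : top_mixing theta A.
Hypothesis tail : forall eps : R, 0 < eps -> exists l, forall x, G x ->
  forall w, E (theta x) w -> (Lpos A phi x (ind_big l) w <= eps%:E)%E.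

(** A signed [f] of zero integral is [(f + 2 S) - 2 S], a difference of two members of the cone of
    constant 1 with equal integrals. *)
Lemma fibre_decay : exists b th : R, [/\ 0 < b, 0 < th, th < 1 &
  forall n x f (S : R) (g : Seq -> R), G x -> 0 <= S -> bounded_by (E x) f S ->
    (forall t w, E x t -> E x w -> t 0%N = w 0%N ->
      `|f t - f w| <= S * seq_dist t w `^ alpha) ->
    (\int[nu x]_(w in E x) (f w)%:E = 0)%E ->
    (nu (iter n theta x)).-integrable (E (iter n theta x)) (EFin \o g) ->
    (`| \int[nu x]_(w in E x) (g (shiftn n w) * f w)%:E | <=
     (b * th ^+ n * S)%:E *
     \int[nu (iter n theta x)]_(w in E (iter n theta x)) `|g w|%:E)%E].
Proof.
have [b [th [b0 th0 th1 hd]]] := transfer_decay Gtheta k1_gt0 k2_gt0 D0_ge1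
  lam_bounds Lpos1 c_gt0 phi_lower followers mixing alpha0 V_ge0 phi_holder
  fibre_int_lin fibre_int_le fibre_int1 fibre_int_Pop tail.
exists b, th; split=> // n x f S g Gx S0 fS hf f0 gi.
have S2 : 0 <= 2 * S by rewrite mulr_ge0.
have If : I x f = 0 by rewrite /fibre_int /Rintegral f0.
have fb : bdd x f by exists S.
have f2b : bdd x (fun t => f t + 2 * S).
  have := bdd_lin (2 * S) fb (bdd_cst theta A x 1).
  by congr (bdd x _); apply/funext => t; rewrite mulr1.
have M0 : 0 <= b * th ^+ n * S by rewrite !mulr_ge0 ?exprn_ge0// ltW.
have := fibre_integral_le ler01 Gx f2b (cone_shift S0 fS hf)
  (bdd_cst theta A x (2 * S)) (cone_cst alpha (E x) ler01 S2) M0 gi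
  (hd n x f S Gx S0 fS hf If).
by under eq_integral do rewrite addrK.
Qed.

End FibreIntegral.

(** * Bounding integrals by almost sure estimates *)

Section IntegralBounds.
Context {R : realType} {d : measure_display} {X : measurableType d}.
Variable m : {measure set X -> \bar R}.
Local Open Scope ereal_scope.

Lemma ge0_le_integralT (f g : X -> \bar R) : (forall x, 0 <= f x) ->
  (forall x, f x <= g x) -> \int[m]_x f x <= \int[m]_x g x.
Proof.
move=> f0 fg; have g0 x : 0 <= g x by exact: le_trans (fg x).
rewrite !ge0_integralTE//; apply: le_ereal_sup => _ [h hf <-].
by exists h => // x; exact: le_trans (fg x).
Qed.

Lemma abse_sub_le (a b c : \bar R) : 0 <= a -> 0 <= b -> a <= c -> b <= c ->
  `|a - b| <= c.
Proof.
move=> a0 b0 ac bc; have c0 := le_trans a0 ac.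
case: c => [c| |] // in c0 ac bc *; last by rewrite leey.
case: a => [a| |] // in a0 ac *; case: b => [b| |] // in b0 bc *.
rewrite !lee_fin in a0 b0 ac bc.
rewrite -EFinB abse_EFin lee_fin ler_norml.
by apply/andP; split; lra.
Qed.

(* The integrand need not be measurable: the library's integral is monotone on
   arbitrary nonnegative functions, and the exceptional set is absorbed by
   making the bound infinite on it. *)
Lemma ae_abse_integral_le (f g : X -> \bar R) : measurable_fun setT g ->
  (forall x, 0 <= g x) -> (\forall x \ae m, `|f x| <= g x) ->
  `| \int[m]_x f x | <= \int[m]_x g x.
Proof.
move=> mg g0 [N [mN N0 hN]].
pose u : X -> \bar R := (cst +oo) \_ N.
have u0 x : 0 <= u x by rewrite /u patchE; case: ifP => _ /=; rewrite ?leey.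
have mu' : measurable_fun setT u.
  by apply/(measurable_restrictT _ mN).1; exact: measurable_cst.
have -> : \int[m]_x g x = \int[m]_x (g x + u x).
  rewrite ge0_integralD//.
  rewrite [X in _ + X](_ : _ = 0) ?adde0//.
  rewrite -integral_mkcond integral_cst//= N0 mule0//.
have fgu x : `|f x| <= g x + u x.
  have [xN|xN] := pselect (N x).
    by rewrite /u patchE mem_set//= addey ?leey// gt_eqF// (lt_le_trans _ (g0 x)).
  rewrite (le_trans _ (leeDl _ (u0 x)))//; apply: contrapT => h.
  by apply: xN; exact: hN.
rewrite integralE; apply: abse_sub_le.
- by apply: integral_ge0 => x _; exact: funepos_ge0.
- by apply: integral_ge0 => x _; exact: funeneg_ge0.
- apply: ge0_le_integralT => x; first exact: funepos_ge0.
  by apply: le_trans (fgu x); rewrite funeposE ge_max lee_abs abse_ge0.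
- apply: ge0_le_integralT => x; first exact: funeneg_ge0.
  by apply: le_trans (fgu x); rewrite funenegE ge_max -abseN lee_abs abse_ge0.
Qed.

End IntegralBounds.

(** * Hölder's inequality and invariance of norms on the base *)

Section HolderLp.
Context {R : realType} {d : measure_display} {X : measurableType d}.
Variable m : probability X R.
Local Open Scope ereal_scope.
Local Notation "'N_ p [ f ]" := (Lnorm m p (EFin \o f)).

(** The norm of infinite exponent is the essential supremum provided that the space has positive
    mass, which a probability guarantees. *)
Lemma LnormyE (f : X -> R) : 'N_+oo[f] = ess_sup m (abse \o (EFin \o f)).
Proof.
have m1 : 0 < m [set: X] by rewrite [m _]probability_setT lte01.
by rewrite Lnorm.unlock ifT.
Qed.

Lemma Lnormy_ge (f : X -> R) : \forall x \ae m, `|f x|%:E <= 'N_+oo[f].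
Proof. by rewrite LnormyE; exact: ess_sup_ge. Qed.

Lemma hoelder_y1 (f g : X -> R) : measurable_fun setT f -> measurable_fun setT g ->
  \int[m]_x `|(f x * g x)%:E| <= 'N_+oo[f] * 'N_1%:E[g].
Proof.
move=> mf mg; rewrite Lnorm1 -ge0_integralZl//; last 2 first.
- by apply: measurableT_comp => //; exact/measurable_EFinP.
- exact: Lnorm_ge0.
apply: ae_ge0_le_integral => //.
- by apply: measurableT_comp => //; apply/measurable_EFinP; exact: measurable_funM.
- by move=> x _; rewrite mule_ge0 ?Lnorm_ge0.
- apply: measurable_funeM; apply: measurableT_comp => //; exact/measurable_EFinP.
apply: filterS (Lnormy_ge f) => x fx _.
by rewrite EFinM abseM lee_wpmul2r.
Qed.

Lemma hoelder_conj (f g : X -> R) p q : measurable_fun setT f ->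
  measurable_fun setT g -> conj_exp p q ->
  \int[m]_x `|(f x * g x)%:E| <= 'N_p[f] * 'N_q[g].
Proof.
move=> mf mg; case: p => [p| |]; case: q => [q| |] //=.
- move=> [p1 [q1 pq]].
  have := hoelder m mf mg (lt_le_trans ltr01 p1) (lt_le_trans ltr01 q1) pq.
  by rewrite Lnorm1.
- move=> ->; rewrite muleC; under eq_integral do rewrite mulrC.
  exact: hoelder_y1.
- by move=> ->; exact: hoelder_y1.
Qed.

Variable T : X -> X.
Hypotheses (mT : measurable_fun setT T)
  (Tm : forall B, measurable B -> m (T @^-1` B) = m B).

Lemma ae_preimage (P : X -> Prop) : (\forall x \ae m, P x) ->
  \forall x \ae m, P (T x).
Proof.
move=> [N [mN N0 hN]]; exists (T @^-1` N); split.
- by rewrite -[_ @^-1` _]setTI; exact: mT.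
- by rewrite Tm.
- by move=> x /= nP; apply: hN.
Qed.

Lemma Lnorm_comp_le (f : X -> R) p : measurable_fun setT f -> 1 <= p ->
  'N_p[f \o T] <= 'N_p[f].
Proof.
move=> mf; case: p => [p| |] //= p1.
- rewrite Lnorm.unlock le_eqVlt; apply/orP; left; apply/eqP; congr (_ `^ _).
  have mg : measurable_fun setT (fun x => `|(f x)%:E| `^ p).
    apply: (@measurableT_comp _ _ _ _ _ _ (fun y => y `^ p)); first exact: measurable_poweR.
    by apply: measurableT_comp => //; exact/measurable_EFinP.
  transitivity (\int[pushforward m T]_x `|(f x)%:E| `^ p).
    by rewrite (ge0_integral_pushforward mT)// => x _; exact: poweR_ge0.
  by apply: eq_measure_integral => B mB _; exact: Tm.
- rewrite !LnormyE; apply/ess_supP; apply: (@ae_preimage (fun x => `|(f x)%:E| <= _)).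
  exact: ess_sup_ge.
Qed.

End HolderLp.

(** * Consequences of mixing and summability *)

Section Hypotheses.
Context {R : realType} {d : measure_display} {X : measurableType d}.
Variables (theta : X -> X) (A : X -> nat -> nat -> bool) (phi : X -> Seq -> R).
Local Notation E := (Efib theta A).

(** Words from [e] to [e] of [N.+2] steps are glued one after another. The word of each block is
    chosen at the base point where the block starts, since the matrices vary along the orbit. *)
Lemma cyl1_nonempty x e : top_mixing theta A -> exists w, cyl1 theta A x e w.
Proof.
move=> mix; have [N hN] := mix e e.
have /choice[f hf] := hN N (leqnn N).
pose L := N.+2; pose base i := iter (i %/ L * L) theta x.
exists (fun i => f (base i) (i %% L)%N); split; last first.
  by rewrite mod0n; have [-> _ _] := hf (base 0%N).
move=> i; have rL : (i %% L < L)%N by rewrite ltn_mod.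
have [_ fL fA] := hf (base i).
have := fA _ rL; rewrite {1}/base -iterD addnC -divn_eq.
suff -> : f (base i.+1) (i.+1 %% L)%N = f (base i) (i %% L).+1 by [].
have iE : i.+1 = (i %/ L * L + (i %% L).+1)%N by rewrite addnS -divn_eq.
have [ltL|] := ltnP (i %% L).+1 L.
  have e1 : (i.+1 %/ L = i %/ L)%N by rewrite {1}iE divnMDl// (divn_small ltL) addn0.
  have e2 : (i.+1 %% L = (i %% L).+1)%N by rewrite {1}iE modnMDl (modn_small ltL).
  by rewrite /base e1 e2.
rewrite leq_eqVlt ltnNge rL orbF => /eqP/esym eL.
have e2 : (i.+1 %% L = 0)%N by rewrite {1}iE eL modnMDl modnn.
by rewrite e2 eL fL; have [-> _ _] := hf (base i.+1).
Qed.

(** Prefixes beyond [l] contribute at most [s]; each of the finitely many others contributes at most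
    its own [C e]. *)
Lemma Lpos_cst1_le x w l (C : nat -> R) (s : R) : E (theta x) w ->
  (forall e, 0 <= C e) ->
  (forall e t, cyl1 theta A x e t -> expR (phi x t) <= C e) ->
  (Lpos A phi x (ind_big l) w <= s%:E)%E ->
  (Lpos A phi x (cst 1%R) w <= (s + \sum_(0 <= e < l.+1) C e)%:E)%E.
Proof.
move=> Ew C0 hC hs.
have b0 t : E x t -> 0 <= (ind_big l t : R) by rewrite /ind_big; case: ifP.
have o0 t : E x t -> 0 <= ((cst 1%R : Seq -> R) t) by move=> _ /=.
pose b e := if (e < l.+1)%N then C e else 0.
have part n : series (Lterm A phi x (cst 1%R) w) n <= s + \sum_(0 <= e < l.+1) C e.
  apply: (@le_trans _ _ (series (Lterm A phi x (ind_big l) w) n + series b n)).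
    rewrite /series/= -big_split/=; apply: ler_sum => e _.
    rewrite /Lterm /b; case: ifP => h; last by rewrite add0r; case: ifP.
    rewrite /ind_big /= ltnS; case: ltnP => el; first by rewrite addr0.
    by rewrite mul0r add0r mul1r; apply: hC; split=> //; exact/Efib_scons.
  apply: lerD.
    by rewrite -lee_fin (le_trans _ hs)//; exact: (series_Lterm_le phi Ew b0).
  apply: (@le_trans _ _ (series b (l.+1 + n)%N)).
    apply: nondecreasing_series; last exact: leq_addl.
    by move=> k _ _; rewrite /b; case: ifP.
  rewrite /series/= (big_cat_nat (leq0n l.+1) (leq_addr n l.+1))/=.
  rewrite [X in _ + X]big_nat_cond [X in _ + X]big1 ?addr0; last first.
    by move=> e /andP[/andP[le _] _]; rewrite /b ltnNge le.
  rewrite big_nat_cond [leRHS]big_nat_cond; apply: ler_sum => e /andP[/andP[_ el] _].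
  by rewrite /b el.
apply: lime_le.
  by apply: is_cvg_nneseries => e _ _; rewrite lee_fin; exact: (Lterm_ge0 phi Ew o0).
by apply: nearW => n; rewrite sumEFin lee_fin; exact: part.
Qed.

End Hypotheses.

Lemma ess_sup_lty {R : realType} {d} {X : measurableType d}
    (m : {measure set X -> \bar R}) (f : X -> \bar R) : (ess_sup m f < +oo)%E ->
  exists2 M : R, 0 <= M & \forall x \ae m, (f x <= M%:E)%E.
Proof.
move=> fo; exists (Num.max 0 (fine (ess_sup m f))); first by rewrite le_max lexx.
apply: filterS (ess_sup_ge m f) => x /le_trans; apply.
case: (ess_sup m f) fo => [r| |]//= _; last by rewrite leNye.
by rewrite lee_fin le_max lexx orbT.
Qed.

(** * Assembly: uniform constants, and integration over the base *)

Unset Implicit Arguments.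

Theorem mainTheorem4 (R : realType) (d : measure_display) (X : measurableType d)
  (m : probability X R) (theta : X -> X) (A : X -> nat -> nat -> bool)
  (alpha : R) (phi : X -> Seq -> R) (kappa : R) (F : set nat)
  (nu : R.-pker X ~> Seq) (lam : X -> R) (rho : X -> Seq -> R) (p q : \bar R) :
  inv_mpt m theta ->
  meas_matrix A ->
  top_mixing theta A ->
  (0 < alpha)%R ->
  fine_pot m theta A alpha phi kappa F ->
  conformal m theta A phi F nu lam ->
  density m theta A alpha phi nu lam rho ->
  conj_exp p q ->
  exists b vartheta : R, [/\ (0 < b)%R, (0 < vartheta)%R, (vartheta < 1)%R &
    forall (g h : X -> Seq -> R) (n : nat),
      in_L1p m theta A nu p g ->
      in_Hq m theta A alpha q h ->
      (\forall x \ae m,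
         (\int[nu x]_(w in Efib theta A x) (h x w * rho x w)%:E = 0)%E) ->
      (1 <= n)%N ->
      (`| \int[m]_x \int[nu x]_(w in Efib theta A x)
            (g (iter n theta x) (shiftn n w) * h x w * rho x w)%:E |
       <= (b * vartheta ^+ n)%:E * L1p_norm m theta A nu p g
                                 * Hq_norm m theta A alpha q h)%E].
Proof.
move=> [_ [thinv [_ _ mth _ thm]]] _ mix alpha0 [[_ _ phiV phib tail0] _ condB0 _]
  [nu1 [_ lam0] lamb conf _] [[_ rhoH [_ rhoLp]] _ _ _] pq.
have mthn n : measurable_fun setT (iter n theta).
  by elim: n => [|n IH] /=; [exact: measurable_id|exact: measurableT_comp].
have thmn n B : measurable B -> m (iter n theta @^-1` B) = m B.
  elim: n B => [//|n IH] B mB.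
  have mB' : measurable (theta @^-1` B) by rewrite -[_ @^-1` _]setTI; exact: mth.
  exact: (etrans (IH _ mB') (thm B mB)).
have [V V0 aeV] := ess_sup_lty phiV.
have [La La0 aeLa] := ess_sup_lty lamb.
have /choice[cC hcC] : forall e, exists z : R * R, [/\ 0 < z.1, z.1 < z.2 &
    \forall x \ae m, forall w, cyl1 theta A x e w ->
      z.1 <= expR (phi x w) /\ expR (phi x w) <= z.2].
  by move=> e; have [c [C [h1 [h2 h3]]]] := phib e; exists (c, C).
have aeB : \forall x \ae m, forall e, (fsup (cyl1 theta A (theta x) e) (Lpos A phi x (cst 1%R))
    <= ess_sup m (fun x => fsup (cyl1 theta A (theta x) e) (Lpos A phi x (cst 1%R))))%E.
  by apply/ae_foralln => e; exact: ess_sup_ge.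
have aeT : \forall x \ae m, forall l, (fsup (Efib theta A (theta x)) (Lpos A phi x (ind_big l))
    <= ess_sup m (fun x => fsup (Efib theta A (theta x)) (Lpos A phi x (ind_big l))))%E.
  by apply/ae_foralln => l; exact: ess_sup_ge.
have aeC : \forall x \ae m, forall e w, cyl1 theta A x e w ->
    (cC e).1 <= expR (phi x w) /\ expR (phi x w) <= (cC e).2.
  by apply/ae_foralln => e; have [] := hcC e.
have [Mr Mr0 aeR] : exists2 M : R, 0 <= M & \forall x \ae m,
    (`|(holder_norm alpha (Efib theta A x) (rho x))%:E| <= M%:E)%E.
  by apply: ess_sup_lty; rewrite -LnormyE.
(* The share of one point in the almost sure hypotheses. Bounds indexed by symbols are countably
   many, so they hold together outside one null set. *)
pose good x := [/\ (var_alpha alpha (Efib theta A x) (phi x) <= V%:E)%E,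
  (`|ln (lam x)|%:E <= La%:E)%E,
  (forall e, (fsup (cyl1 theta A (theta x) e) (Lpos A phi x (cst 1%R))
    <= ess_sup m (fun x => fsup (cyl1 theta A (theta x) e) (Lpos A phi x (cst 1%R))))%E),
  (forall l, (fsup (Efib theta A (theta x)) (Lpos A phi x (ind_big l))
    <= ess_sup m (fun x => fsup (Efib theta A (theta x)) (Lpos A phi x (ind_big l))))%E) &
  [/\ forall e w, cyl1 theta A x e w ->
      (cC e).1 <= expR (phi x w) /\ expR (phi x w) <= (cC e).2,
    nu x (Efib theta A x) = 1%E &
    forall g : Seq -> R,
        cont_on (Efib theta A x) g -> (sup_norm (Efib theta A x) g < +oo)%E ->
        (\int[nu (theta x)]_(w in Efib theta A (theta x)) (Lop A phi x g w)%:E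
        = (lam x)%:E * \int[nu x]_(w in Efib theta A x) (g w)%:E)%E]].
have ae_good : \forall x \ae m, good x.
  apply: filterS (filterI aeV (filterI aeLa (filterI aeB
    (filterI aeT (filterI aeC (filterI nu1 conf)))))).
  by move=> x [? [? [? [? [? [? ?]]]]]]; split.
(* Requiring the bounds along the whole forward orbit makes [G] invariant; it keeps full measure as
   a countable intersection of preimages under measure-preserving maps. *)
pose G : set X := [set x | forall n, good (iter n theta x)].
have aeG : \forall x \ae m, G x.
  by apply/ae_foralln => n; exact: (ae_preimage (mthn n) (thmn n) ae_good).
have Ggood x : G x -> good x by move=> /(_ 0%N).
have Gtheta x : G x -> G (theta x) by move=> Gx n; rewrite -iterSr; exact: Gx.
have tail (eps : R) : 0 < eps -> exists l, forall x, G x ->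
    forall w, Efib theta A (theta x) w -> (Lpos A phi x (ind_big l) w <= eps%:E)%E.
  move=> eps0; have e0 : (0 < eps%:E :> \bar R)%E by rewrite lte_fin.
  have [l _ /(_ l (leqnn l)) hl] := tail0 _ (open_ereal_lt' e0).
  exists l => x /Ggood[_ _ _ /(_ l) h _] w Ew.
  apply: le_trans (ltW hl); apply: le_trans h.
  by apply: ereal_sup_ubound; exists w.
have c0 e : 0 < (cC e).1 by have [] := hcC e.
have C0 e : 0 <= (cC e).2 by have [h h' _] := hcC e; rewrite ltW// (lt_trans h).
(* If [e'] may follow [e], a point of the nonempty cylinder of [e'] over [theta x] has a preimage
   starting with [e], so [L 1] is at least [c_e] there. Condition (B) excludes this for large
   [e']. *)
have followers e : exists r, forall x, G x -> forall e', A x e e' -> (e' <= r)%N.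
  have e0 : (0 < (cC e).1%:E :> \bar R)%E by rewrite lte_fin.
  have [r _ hr] := condB0 _ (open_ereal_lt' e0).
  exists r => x Gx e' Aee'; rewrite leqNgt; apply/negP => re'.
  have [_ _ /(_ e') h _ [hc _ _]] := Ggood x Gx.
  have [w [Ew we]] := cyl1_nonempty (theta x) e' mix.
  have Ex : Efib theta A x (scons e w) by apply/Efib_scons; rewrite we.
  have /= hlt := hr e' (ltnW re').
  have o0 t : Efib theta A x t -> 0 <= ((cst 1%R : Seq -> R) t) by move=> _ /=.
  have : ((cC e).1%:E <= Lpos A phi x (cst 1%R) w)%E.
    apply: le_trans (series_Lterm_le phi Ew o0 e.+1).
    rewrite lee_fin seriesSr {2}/Lterm we Aee' mul1r.
    rewrite (le_trans (hc e _ (conj Ex erefl)).1)// lerDr.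
    by apply: sumr_ge0 => k _; exact: Lterm_ge0.
  have sup : (Lpos A phi x (cst 1%R) w <=
      fsup (cyl1 theta A (theta x) e') (Lpos A phi x (cst 1%R)))%E.
    by apply: ereal_sup_ubound; exists w.
  move=> /le_trans /(_ sup) /le_trans /(_ h).
  by move=> /le_lt_trans /(_ hlt); rewrite ltxx.
have [l1 hl1] := tail 1 ltr01.
(* A uniform bound for [L 1]: symbols beyond [l1] contribute at most 1, the others at most the sum
   of their upper constants. *)
pose D := 1 + \sum_(0 <= e < l1.+1) (cC e).2.
have D1 : 1 <= D by rewrite lerDl sumr_ge0.
have k20 : 0 < expR La by exact: expR_gt0.
have k21 : 1 <= expR La by rewrite -expR0 ler_expR.
have D01 : 1 <= D * expR La by rewrite mulr_ege1.
have lam_bounds x : G x -> expR (- La) <= (lam x)^-1 /\ (lam x)^-1 <= expR La.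
  move=> /Ggood[_ + _ _ _]; rewrite lee_fin ler_norml => /andP[h1 h2].
  have -> : (lam x)^-1 = expR (- ln (lam x)) by rewrite expRN lnK// posrE.
  by rewrite !ler_expR lerN2 lerNl; split.
have Lpos1 x : G x -> forall w, Efib theta A (theta x) w ->
    (Lpos A phi x (cst 1%R) w <= ((D * expR La) / expR La)%:E)%E.
  move=> Gx w Ew; rewrite mulfK ?gt_eqF//.
  apply: Lpos_cst1_le => //; last exact: hl1.
  by move=> e t /((let: And5 _ _ _ _ (And3 h _ _) := Ggood x Gx in h) e t)[].
have phi_holder x : G x -> forall t w, Efib theta A x t -> Efib theta A x w ->
    t 0%N = w 0%N -> `|phi x t - phi x w| <= V * seq_dist t w `^ alpha.
  by move=> /Ggood[h _ _ _ _]; exact: var_alpha_dist h.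
have phi_lower x : G x -> forall w, Efib theta A x w -> (cC (w 0%N)).1 <= expR (phi x w).
  by move=> /Ggood[_ _ _ _ [h _ _]] w Ew; have [] := h (w 0%N) w (conj Ew erefl).
have nuE x : G x -> nu x (Efib theta A x) = 1%E by move=> /Ggood[_ _ _ _ []].
have confG x : G x -> forall g : Seq -> R,
    cont_on (Efib theta A x) g -> (sup_norm (Efib theta A x) g < +oo)%E ->
    (\int[nu (theta x)]_(w in Efib theta A (theta x)) (Lop A phi x g w)%:E
     = (lam x)%:E * \int[nu x]_(w in Efib theta A x) (g w)%:E)%E.
  by move=> /Ggood[_ _ _ _ []].
have [b [th [b0 th0 th1 hd]]] := fibre_decay Gtheta (expR_gt0 (- La)) k20 D01
  lam_bounds Lpos1 alpha0 V0 phi_holder nuE confG c0 phi_lower followers mix tail.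
(* [Mr] bounds the Hölder norm of [rho] almost surely, for the weight of the fibre estimate is
   [h rho]; the added 1 keeps the constant positive. *)
exists (b * (Mr + 1)), th; split=> //; first by rewrite mulr_gt0// ltr_wpDl.
move=> g h n [_ gint [mLg gLp]] [_ hH [mLh hLp]] hzero _.
set hn := fun x => holder_norm alpha (Efib theta A x) (h x).
set gn := L1fib theta A nu g.
have k0 : 0 <= b * (Mr + 1) * th ^+ n.
  by rewrite !mulr_ge0 ?addr_ge0 ?exprn_ge0 ?(ltW b0) ?(ltW th0).
have mgn : measurable_fun setT (gn \o iter n theta) by exact: measurableT_comp.
have mprod : measurable_fun setT (fun x => `|(gn (iter n theta x) * hn x)%:E|%E).
  apply: measurableT_comp => //; apply/measurable_EFinP; exact: measurable_funM.
have p1 : (1 <= p)%E.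
  move: pq; case: (p) => [p'| |]; case: (q) => [q'| |] //=; last by rewrite leey.
    by case=> p'1 _; rewrite lee_fin.
  by move=> ->.
(* The fibre estimate bounds the inner integral by a product of two fibre norms. Hölder's inequality
   on [X] separates them, and invariance of [m] removes [theta^n] from the norm of [g]. *)
apply: (@le_trans _ _ (\int[m]_x ((b * (Mr + 1) * th ^+ n)%:E *
    `|(gn (iter n theta x) * hn x)%:E|))%E); last first.
  rewrite ge0_integralZl//.
  rewrite -muleA lee_wpmul2l ?lee_fin//.
  apply: le_trans (hoelder_conj m mgn mLh pq) _.
  rewrite lee_wpmul2r ?Lnorm_ge0//.
  exact: (Lnorm_comp_le (mthn n) (thmn n) mLg p1).
apply: ae_abse_integral_le.
- exact: measurable_funeM.
- by move=> x; rewrite mule_ge0 ?abse_ge0// lee_fin.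
(* Integrability of [g] is needed on the fibre over [theta^n x]; null sets have null preimages. *)
have gint' := ae_preimage (mthn n) (thmn n) gint.
apply: filterS (filterI aeG (filterI rhoH (filterI aeR (filterI hH (filterI hzero gint'))))).
move=> x [Gx [rHx [rMx [hHx [h0x gx]]]]].
have [bS hS] := holderM hHx rHx.
have S0 : 0 <= holder_norm alpha (Efib theta A x) (h x) *
    holder_norm alpha (Efib theta A x) (rho x).
  by rewrite mulr_ge0 ?holder_norm_ge0.
have := hd n x _ _ (g (iter n theta x)) Gx S0 bS hS h0x gx.
have -> : (\int[nu x]_(w in Efib theta A x)
      (g (iter n theta x) (shiftn n w) * (h x w * rho x w))%:E =
    \int[nu x]_(w in Efib theta A x)
      (g (iter n theta x) (shiftn n w) * h x w * rho x w)%:E)%E.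
  by apply: eq_integral => w _; rewrite mulrA.
move=> /le_trans; apply.
have gfin : (\int[nu (iter n theta x)]_(w in Efib theta A (iter n theta x))
    `|g (iter n theta x) w|%:E)%E \is a fin_num.
  rewrite ge0_fin_numE; last by apply: integral_ge0 => w _; rewrite lee_fin.
  by have /integrableP[_] := gx.
rewrite -(fineK gfin) -!EFinM lee_fin -/(L1fib theta A nu g (iter n theta x)).
have gn0 : 0 <= gn (iter n theta x).
  by rewrite /gn /L1fib fine_ge0// integral_ge0// => w _; rewrite lee_fin.
have hn0 : 0 <= hn x by exact: holder_norm_ge0.
have rM : holder_norm alpha (Efib theta A x) (rho x) <= Mr + 1.
  move: rMx; rewrite abse_EFin lee_fin => /(le_trans (ler_norm _)) /le_trans; apply.
  by rewrite lerDl.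
rewrite ger0_norm ?mulr_ge0// -/(gn _) -/(hn x).
rewrite [leRHS](_ : _ = b * th ^+ n * (hn x * (Mr + 1)) * gn (iter n theta x)); last by ring.
by rewrite ler_wpM2r// ler_wpM2l ?mulr_ge0 ?exprn_ge0 ?(ltW b0) ?(ltW th0)// ler_wpM2l.
Qed.
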